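(* Let $k$ be an algebraically closed field and let $m,n\ge 2$ be integers with $\gcd(m,n)=1$ and $(mn)^{-1}\in k$ (i.e. $mn$ is invertible in $k$). Let $S = k[X_1,X_2,Y]/(X_1^m+X_2^m+Y^n)$, graded by $\deg X_1=\deg X_2=n$ and $\deg Y=m$, and let $T=k[X_1,X_2]$ with $\deg X_1=\deg X_2=n$, regarded as a graded subring of $S$. If $R$ is any graded ring with inclusions of graded rings $T\subseteq R\subseteq S$, then the first Chow group $A_1(R)$ is a torsion group.
   Context: For an affine algebra $R$ over a field (here $R$ is a finite $T$-module, hence affine), Chow groups are defined as follows, where $\dim$ is Krull dimension. $Z_i(R)$ is the free abelian group with basis the symbols $[R/P]$, $P$ a prime ideal of $R$ with $\dim R/P=i$. For a finitely generated $R$-module $M$ with $\dim M\le i$, put $[M]_i=\sum_{\dim R/P=i}\operatorname{length}(M_P)\,[R/P]\in Z_i(R)$. For a prime $Q$ with $\dim R/Q=i+1$ and an element $x\in R\setminus Q$, put $\operatorname{div}(Q,x)=[(R/Q)/x(R/Q)]_i$. The Chow group $A_i(R)$ is the quotient of $Z_i(R)$ by the subgroup generated by all $\operatorname{div}(Q,x)$ with $Q$ prime, $\dim R/Q=i+1$, and $x\notin Q$ (rational equivalence). *)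

(* Defs.v *)
From HB Require Import structures.
From mathcomp Require Import all_boot all_order all_algebra.
From mathcomp Require Import boolp classical_sets fsbigop.
From mathcomp Require Import freeg mpoly ring.

Set Implicit Arguments.
Unset Strict Implicit.
Unset Printing Implicit Defensive.

Import GRing.Theory.
Local Open Scope ring_scope.
Local Open Scope quotient_scope.

Local Notation quot := (@Quotient.quot _).

(* A chain of n strict inclusions c 0 < c 1 < ... < c n among the sets indexed
   by X; max_chain d says that d is the supremum of the lengths of chains. *)
Definition proper_subset (T : Type) (A B : {pred T}) : Prop :=
  {subset A <= B} /\ ~ {subset B <= A}.

Definition has_chain (T X : Type) (set_of : X -> {pred T}) (n : nat) : Prop :=
  exists c : nat -> X,
    forall i, (i < n)%N -> proper_subset (set_of (c i)) (set_of (c i.+1)).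

Definition max_chain (T X : Type) (set_of : X -> {pred T}) (d : nat) : Prop :=
  has_chain set_of d /\ forall n, has_chain set_of n -> (n <= d)%N.

Section Spec.
Variable A : comNzRingType.

(* prime_idealr A lives in a universe too large for a choiceType. *)
Definition spec :=
  {P : A -> bool | `[< idealr_closed P /\ prime_idealr_closed P >]}.
HB.instance Definition _ := Choice.on spec.

Definition spec_set (P : spec) : {pred A} := sval P.

Fact spec_set_idealr (P : spec) : idealr_closed (spec_set P).
Proof. by have /asboolP[] := svalP P. Qed.
Fact spec_set_prime (P : spec) : prime_idealr_closed (spec_set P).
Proof. by have /asboolP[] := svalP P. Qed.

HB.instance Definition _ (P : spec) :=
  isIdealr.Build A (spec_set P) (spec_set_idealr P).
HB.instance Definition _ (P : spec) :=
  isPrimeIdealrClosed.Build A (spec_set P) (@spec_set_prime P).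

Definition prime_of_spec (P : spec) : prime_idealr A := spec_set P.

End Spec.
Coercion prime_of_spec : spec >-> prime_idealr.

Definition has_krull_dim (A : comNzRingType) (d : nat) : Prop :=
  max_chain (@spec_set A) d.

Definition has_length (A : pzRingType) (M : lmodType A) (l : nat) : Prop :=
  max_chain (fun N : submodClosed M => N : {pred M}) l.

(* By convention 0 when the length is infinite. *)
Definition mod_length (A : pzRingType) (M : lmodType A) : nat :=
  xget 0%N [set l | has_length M l]%classic.

Section ModuleQuotient.
Variables (A : pzRingType) (M : lmodType A) (N : submodClosed M).

(* A copy of N that also carries the closure under opposites. *)
Definition submod_set : {pred M} := N.

Fact submod_set_closed : submod_closed submod_set.
Proof. exact: submodClosedP. Qed.

HB.instance Definition _ :=
  GRing.isSubmodClosed.Build A M submod_set submod_set_closed.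

Definition mod_quot : Type := quot submod_set.

HB.instance Definition _ := GRing.Zmodule.on mod_quot.

Definition mod_quot_scale (a : A) (x : mod_quot) : mod_quot :=
  \pi_(quot submod_set) (a *: repr x).

Lemma mod_quot_scaleE a (v : M) :
  mod_quot_scale a (\pi_(quot submod_set) v) = \pi_(quot submod_set) (a *: v).
Proof.
apply/eqP; rewrite -Quotient.idealrBE -scalerBr rpredZ //.
by rewrite Quotient.idealrBE reprK.
Qed.

Fact mod_quot_scaleA a b x :
  mod_quot_scale a (mod_quot_scale b x) = mod_quot_scale (a * b) x.
Proof.
by rewrite -[x](@reprK _ (quot submod_set)) !mod_quot_scaleE scalerA.
Qed.

Fact mod_quot_scale1 : left_id 1 mod_quot_scale.
Proof.
move=> x; rewrite -[x](@reprK _ (quot submod_set)).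
by rewrite mod_quot_scaleE scale1r.
Qed.

Fact mod_quot_scaleDr : right_distributive mod_quot_scale +%R.
Proof.
move=> a x y; rewrite -[x](@reprK _ (quot submod_set)).
rewrite -[y](@reprK _ (quot submod_set)) !mod_quot_scaleE.
rewrite -[LHS]/(mod_quot_scale a (_ + _ : (quot submod_set))).
rewrite -(raddfD (\pi_(quot submod_set))) mod_quot_scaleE scalerDr.
exact: (raddfD (\pi_(quot submod_set))).
Qed.

Fact mod_quot_scaleDl x : {morph mod_quot_scale^~ x : a b / a + b}.
Proof.
move=> a b; rewrite -[x](@reprK _ (quot submod_set)) !mod_quot_scaleE.
rewrite scalerDl; exact: (raddfD (\pi_(quot submod_set))).
Qed.

HB.instance Definition _ := GRing.Zmodule_isLmodule.Build A mod_quot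
  mod_quot_scaleA mod_quot_scale1 mod_quot_scaleDr mod_quot_scaleDl.

End ModuleQuotient.

Section Localization.
Variables (R : comNzRingType) (P : prime_idealr R).

Definition denom : Type := {s : R | s \notin P}.
HB.instance Definition _ := Choice.on denom.
Definition den (s : denom) : R := sval s.
Arguments den : simpl never.

Fact denom1_subproof : 1 \notin P. Proof. by rewrite idealr1. Qed.
Definition denom1 : denom := exist _ (1 : R) denom1_subproof.

Fact denomM_subproof (s t : denom) : den s * den t \notin P.
Proof. by rewrite prime_idealrM negb_or (svalP s) (svalP t). Qed.
Definition denomM (s t : denom) : denom :=
  exist _ (den s * den t) (denomM_subproof s t).

Lemma den1 : den denom1 = 1. Proof. by []. Qed.
Lemma denM s t : den (denomM s t) = den s * den t. Proof. by []. Qed.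

Section Module.
Variable M : lmodType R.

Definition loc_equiv (x y : M * denom) : bool :=
  `[< exists u : denom,
        den u *: (den y.2 *: x.1) = den u *: (den x.2 *: y.1) >].

Fact loc_equiv_refl : reflexive loc_equiv.
Proof. by move=> x; apply/asboolP; exists denom1. Qed.

Fact loc_equiv_sym : ssrbool.symmetric loc_equiv.
Proof. by move=> x y; apply/asboolP/asboolP => -[u e]; exists u. Qed.

Fact loc_equiv_trans : transitive loc_equiv.
Proof.
move=> [l s] [m t] [n r] /asboolP[u /= e1] /asboolP[v /= e2].
apply/asboolP; exists (denomM (denomM u v) s); rewrite /= !denM.
transitivity ((den v * den r) *: (den u *: (den s *: m))).
  by rewrite !scalerA; congr (_ *: _); ring.
rewrite e1.
transitivity ((den u * den t) *: (den v *: (den r *: l))).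
  by rewrite !scalerA; congr (_ *: _); ring.
by rewrite e2 !scalerA; congr (_ *: _); ring.
Qed.

Canonical loc_equiv_rel :=
  EquivRel loc_equiv loc_equiv_refl loc_equiv_sym loc_equiv_trans.

Definition loc_mod : Type := {eq_quot loc_equiv}.
HB.instance Definition _ := Choice.on loc_mod.

Definition frac (m : M) (s : denom) : loc_mod :=
  \pi_({eq_quot loc_equiv}) (m, s).

Lemma fracP (x : loc_mod) : exists m s, x = frac m s.
Proof.
exists (repr (x : {eq_quot loc_equiv})).1, (repr (x : {eq_quot loc_equiv})).2.
by rewrite /frac -surjective_pairing reprK.
Qed.

Lemma frac_eqP (m n : M) (s t : denom) :
  frac m s = frac n t <->
  exists u : denom, den u *: (den t *: m) = den u *: (den s *: n).
Proof.
split; first by move=> /eqquotP/asboolP.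
by move=> h; apply/eqquotP/asboolP.
Qed.

Definition loc_add (x y : loc_mod) : loc_mod :=
  let: (m, s) := repr (x : {eq_quot loc_equiv}) in
  let: (n, t) := repr (y : {eq_quot loc_equiv}) in
  frac (den t *: m + den s *: n) (denomM s t).

Definition loc_opp (x : loc_mod) : loc_mod :=
  let: (m, s) := repr (x : {eq_quot loc_equiv}) in frac (- m) s.

Definition loc_zero : loc_mod := frac 0 denom1.

Lemma repr_frac m s n t :
  repr (frac m s : {eq_quot loc_equiv}) = (n, t) -> frac n t = frac m s.
Proof. by rewrite /frac => <-; rewrite reprK. Qed.

Lemma loc_addE m n s t :
  loc_add (frac m s) (frac n t) = frac (den t *: m + den s *: n) (denomM s t).
Proof.
rewrite /loc_add; case e1: (repr _) => [m' s']; case e2: (repr _) => [n' t'].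
have /frac_eqP[u eu] := repr_frac e1; have /frac_eqP[v ev] := repr_frac e2.
apply/frac_eqP; exists (denomM u v); rewrite !denM !scalerDr.
congr (_ + _).
  transitivity ((den v * den t * den t') *: (den u *: (den s *: m'))).
    by rewrite !scalerA; congr (_ *: _); ring.
  by rewrite eu !scalerA; congr (_ *: _); ring.
transitivity ((den u * den s * den s') *: (den v *: (den t *: n'))).
  by rewrite !scalerA; congr (_ *: _); ring.
by rewrite ev !scalerA; congr (_ *: _); ring.
Qed.

Lemma loc_oppE m s : loc_opp (frac m s) = frac (- m) s.
Proof.
rewrite /loc_opp; case e1: (repr _) => [m' s'].
have /frac_eqP[u eu] := repr_frac e1.
by apply/frac_eqP; exists u; rewrite !scalerN eu.
Qed.

Lemma frac_eq (m n : M) (s t : denom) :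
  den t *: m = den s *: n -> frac m s = frac n t.
Proof. by move=> e; apply/frac_eqP; exists denom1; rewrite e. Qed.

Fact loc_addA : associative loc_add.
Proof.
move=> x y z; have [m [s ->]] := fracP x.
have [n [t ->]] := fracP y; have [l [r ->]] := fracP z.
rewrite !loc_addE; apply: frac_eq; rewrite ?denM ?den1.
rewrite !scalerDr !scalerA -!addrA.
by congr (_ *: _ + (_ *: _ + _ *: _)); ring.
Qed.

Fact loc_addC : commutative loc_add.
Proof.
move=> x y; have [m [s ->]] := fracP x; have [n [t ->]] := fracP y.
rewrite !loc_addE; apply: frac_eq; rewrite ?denM ?den1.
by rewrite addrC [den t * _]mulrC.
Qed.

Fact loc_add0 : left_id loc_zero loc_add.
Proof.
move=> x; have [m [s ->]] := fracP x.
rewrite /loc_zero loc_addE; apply: frac_eq; rewrite ?denM ?den1.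
by rewrite scaler0 add0r mul1r scale1r.
Qed.

Fact loc_addN : left_inverse loc_zero loc_opp loc_add.
Proof.
move=> x; have [m [s ->]] := fracP x.
rewrite loc_oppE loc_addE; apply: frac_eq; rewrite ?denM ?den1.
by rewrite scalerN addNr !scaler0.
Qed.

HB.instance Definition _ :=
  GRing.isZmodule.Build loc_mod loc_addA loc_addC loc_add0 loc_addN.

Lemma fracD m n s t :
  frac m s + frac n t = frac (den t *: m + den s *: n) (denomM s t).
Proof. exact: loc_addE. Qed.

End Module.

(* The carrier of the local ring R_P is that of the localization of the
   R-module R. *)
Definition loc_ring : Type := loc_mod R^o.
HB.instance Definition _ := GRing.Zmodule.on loc_ring.

Definition loc_scale (M : lmodType R) (a : loc_ring) (x : loc_mod M) :
    loc_mod M :=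
  let: (b, s) := repr (a : {eq_quot (@loc_equiv R^o)}) in
  let: (m, t) := repr (x : {eq_quot (@loc_equiv M)}) in
  frac ((b : R) *: m) (denomM s t).

Lemma loc_scaleE (M : lmodType R) (b : R^o) (m : M) s t :
  loc_scale (frac b s) (frac m t) = frac ((b : R) *: m) (denomM s t).
Proof.
rewrite /loc_scale; case e1: (repr _) => [b' s']; case e2: (repr _) => [m' t'].
have /frac_eqP[u eu] := repr_frac e1; have /frac_eqP[v ev] := repr_frac e2.
have {}eu : den u * (den s * (b' : R)) = den u * (den s' * (b : R)) := eu.
apply/frac_eqP; exists (denomM u v); rewrite !denM.
transitivity ((den u * (den s * (b' : R))) *: (den v *: (den t *: m'))).
  by rewrite !scalerA; congr (_ *: _); ring.
by rewrite eu ev !scalerA; congr (_ *: _); ring.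
Qed.

Fact loc_scaleDr (M : lmodType R) (a : loc_ring) (x y : loc_mod M) :
  loc_scale a (x + y) = loc_scale a x + loc_scale a y.
Proof.
have [b [r ->]] := fracP a; have [m [s ->]] := fracP x.
have [n [t ->]] := fracP y.
rewrite fracD !loc_scaleE fracD; apply: frac_eq; rewrite !denM !scalerDr.
by rewrite !scalerA; congr (_ *: _ + _ *: _); ring.
Qed.

Fact loc_scaleDl (M : lmodType R) (a b : loc_ring) (x : loc_mod M) :
  loc_scale (a + b) x = loc_scale a x + loc_scale b x.
Proof.
have [c [r ->]] := fracP a; have [d [s ->]] := fracP b.
have [m [t ->]] := fracP x.
rewrite fracD !loc_scaleE fracD; apply: frac_eq; rewrite !denM.
have -> : (den s *: c + den r *: d : R^o) = den s * (c : R) + den r * (d : R).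
  by [].
by rewrite scalerDl !scalerDr !scalerA; congr (_ *: _ + _ *: _); ring.
Qed.

Definition loc_mul (a b : loc_ring) : loc_ring := loc_scale a b.
Definition loc_one : loc_ring := frac (1 : R^o) denom1.

Fact loc_scaleA (M : lmodType R) (a b : loc_ring) (x : loc_mod M) :
  loc_scale a (loc_scale b x) = loc_scale (loc_mul a b) x.
Proof.
have [c [r ->]] := fracP a; have [d [s ->]] := fracP b.
have [m [t ->]] := fracP x.
rewrite /loc_mul !loc_scaleE; apply: frac_eq; rewrite !denM.
have -> : ((c : R) *: d : R^o) = (c : R) * (d : R) by [].
by rewrite !scalerA; congr (_ *: _); ring.
Qed.

Fact loc_scale1 (M : lmodType R) (x : loc_mod M) : loc_scale loc_one x = x.
Proof.
have [m [t ->]] := fracP x; rewrite loc_scaleE.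
by apply: frac_eq; rewrite denM den1 scale1r mul1r.
Qed.

Fact loc_mulC : commutative loc_mul.
Proof.
move=> a b; have [c [r ->]] := fracP a; have [d [s ->]] := fracP b.
rewrite /loc_mul !loc_scaleE; apply: frac_eq; rewrite !denM.
have mC (u v : R) : (u *: (v : R^o) : R^o) = v *: (u : R^o) by exact: mulrC.
by rewrite [den r * _]mulrC [_ *: d]mC.
Qed.

Fact loc_mulA : associative loc_mul.
Proof. move=> a b c; exact: loc_scaleA. Qed.

Fact loc_mul1 : left_id loc_one loc_mul.
Proof. move=> a; exact: loc_scale1. Qed.

Fact loc_mulDl : left_distributive loc_mul +%R.
Proof. move=> a b c; exact: loc_scaleDl. Qed.

Fact loc_one_neq0 : loc_one != 0.
Proof.
apply/eqP => /frac_eqP[u]; rewrite den1 !scale1r scaler0 => u0.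
have {}u0 : den u * 1 = 0 := u0.
by have := svalP u; rewrite -/(den u) -[den u]mulr1 u0 idealr0.
Qed.

HB.instance Definition _ := GRing.Zmodule_isComNzRing.Build loc_ring
  loc_mulA loc_mulC loc_mul1 loc_mulDl loc_one_neq0.

HB.instance Definition _ (M : lmodType R) :=
  GRing.Zmodule_isLmodule.Build loc_ring (loc_mod M)
    (@loc_scaleA M) (@loc_scale1 M) (@loc_scaleDr M)
    (fun x a b => @loc_scaleDl M a b x).

End Localization.

Section Chow.
Variable R : comNzRingType.

(* dim R/P = i *)
Definition has_coheight (P : spec R) (i : nat) : Prop :=
  has_krull_dim {ideal_quot (prime_of_spec P)} i.

Definition prime_of_dim (i : nat) := {P : spec R | `[< has_coheight P i >]}.
HB.instance Definition _ i := Choice.on (prime_of_dim i).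

Definition cycles (i : nat) : zmodType := {freeg (prime_of_dim i)}.

Definition loc_length (P : spec R) (M : lmodType R) : nat :=
  mod_length (loc_mod P M : lmodType (loc_ring P)).

(* The class [M]_i. The sum ranges over the primes whose coefficient is not
   zero, and is 0 if these are infinitely many; over an affine algebra, for M
   finitely generated with dim M <= i, they are finitely many and the lengths
   are finite, so neither this default value nor that of mod_length is met. *)
Definition cycle_of (i : nat) (M : lmodType R) : cycles i :=
  \sum_(P \in [set: prime_of_dim i]%classic)
    [freeg [:: ((loc_length (sval P) M)%:Z, P)]].

Section Div.
Variable Q : spec R.

Definition ideal_set : {pred R^o} := spec_set Q.

Fact ideal_set_closed : submod_closed ideal_set.
Proof.
split; first exact: (idealr0 Q).
move=> a u v uQ vQ; apply: (rpredD (S := spec_set Q)) => //; exact: idealMr.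
Qed.

HB.instance Definition _ :=
  GRing.isSubmodClosed.Build R R^o ideal_set ideal_set_closed.

End Div.

Section Multiples.
Variables (M : lmodType R) (x : R).

Definition multiples : {pred M} := [pred v | `[< exists w, v = x *: w >]].

Fact multiples_closed : submod_closed multiples.
Proof.
split; first by apply/asboolP; exists 0; rewrite scaler0.
move=> a u v /asboolP[u' ->] /asboolP[v' ->]; apply/asboolP.
by exists (a *: u' + v'); rewrite scalerDr !scalerA mulrC.
Qed.

HB.instance Definition _ :=
  GRing.isSubmodClosed.Build R M multiples multiples_closed.

End Multiples.

(* The R-module (R/Q) / x(R/Q); mod_quot (ideal_set Q) is R/Q as an R-module. *)
Definition div_cycle (i : nat) (Q : spec R) (x : R) : cycles i :=
  cycle_of i (mod_quot (@multiples (mod_quot (ideal_set Q)) x)).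

Definition rat_relators (i : nat) : set (cycles i) :=
  [set c | exists (Q : spec R) (x : R),
     [/\ has_coheight Q i.+1, x \notin spec_set Q & c = div_cycle i Q x]]%classic.

End Chow.

Section GeneratedSubgroup.
Variables (V : zmodType) (B : set V).

Definition subgroup_gen : {pred V} :=
  [pred v | `[< forall H : zmodClosed V, (B `<=` [set` H])%classic -> v \in H >]].

Fact subgroup_gen_closed : zmod_closed subgroup_gen.
Proof.
split=> [|u v /asboolP Bu /asboolP Bv]; apply/asboolP => H BH; first exact: rpred0.
by apply: rpredB; [exact: Bu | exact: Bv].
Qed.

HB.instance Definition _ :=
  GRing.isZmodClosed.Build V subgroup_gen subgroup_gen_closed.

End GeneratedSubgroup.

Definition chow (R : comNzRingType) (i : nat) : zmodType :=
  quot (subgroup_gen (@rat_relators R i)).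

Definition is_torsion (V : zmodType) : Prop :=
  forall v : V, exists2 N : nat, (0 < N)%N & v *+ N = 0.

(* A grading A = \oplus_d G_d by additive subgroups, indexed by nat. *)
Record is_grading (A : comNzRingType) (G : nat -> {pred A}) : Prop := {
  grading_zmod : forall d, zmod_closed (G d);
  grading_one : 1 \in G 0%N;
  grading_mul : forall d e x y, x \in G d -> y \in G e -> x * y \in G (d + e)%N;
  grading_sum : forall x, exists N (f : nat -> A),
    (forall d, f d \in G d) /\ x = \sum_(d < N) f d;
  grading_direct : forall N (f : nat -> A), (forall d, f d \in G d) ->
    \sum_(d < N) f d = 0 -> forall d, (d < N)%N -> f d = 0
}.

Definition graded_map (A B : Type) (G : nat -> {pred A}) (H : nat -> {pred B})
    (f : A -> B) : Prop :=
  forall d x, x \in G d -> f x \in H d.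

Section WeightedDegree.
Variables (n : nat) (w : 'I_n -> nat).

Definition wdeg (m : 'X_{1..n}) : nat := (\sum_(i < n) w i * m i)%N.

Fact wdeg0 : wdeg 0%MM = 0%N.
Proof. by apply: big1 => i _; rewrite mnm0E muln0. Qed.

Fact wdegD : {morph wdeg : m1 m2 / (m1 + m2)%MM >-> (m1 + m2)%N}.
Proof.
move=> m1 m2; rewrite /wdeg -big_split; apply: eq_bigr => i _.
by rewrite mnmDE mulnDr.
Qed.

HB.instance Definition _ := isMeasure.Build n wdeg wdeg0 wdegD.

End WeightedDegree.

Definition whomog (k : comNzRingType) (n : nat) (w : 'I_n -> nat) (d : nat) :
    {pred {mpoly k[n]}} :=
  [pred p | p \is d.-homog for (wdeg w)].

Section FermatHypersurface.
Variables (k : fieldType) (m n : nat).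

(* The k[X_1, X_2] of T_graded sits in k[X_1, X_2, Y] through mwiden, which
   keeps the indices 0 and 1. *)
Definition var1 : 'I_3 := @Ordinal 3 0 isT.
Definition var2 : 'I_3 := @Ordinal 3 1 isT.
Definition varY : 'I_3 := @Ordinal 3 2 isT.

Definition fermat_poly : {mpoly k[3]} :=
  'X_var1 ^+ m + 'X_var2 ^+ m + 'X_varY ^+ n.

Definition wtT (i : 'I_2) : nat := n.
Definition wtS (i : 'I_3) : nat := if i == varY then m else n.

Definition T_graded (d : nat) : {pred {mpoly k[2]}} := whomog wtT d.

(* The bounds make the ideal proper, as {ideal_quot _} requires. *)
Variables (hm : (1 < m)%N) (hn : (1 < n)%N).

Definition fermat_ideal of (1 < m)%N & (1 < n)%N : {pred {mpoly k[3]}} :=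
  [pred p | `[< exists q, p = q * fermat_poly >]].

Fact fermat_ideal_closed : idealr_closed (fermat_ideal hm hn).
Proof.
split.
- by apply/asboolP; exists 0; rewrite mul0r.
- apply/asboolP => -[q e].
  have := congr1 (meval (fun=> 0)) e.
  rewrite rmorph1 rmorphM !rmorphD !rmorphXn /= !mevalXU.
  rewrite !expr0n (gtn_eqF (ltnW hm)) (gtn_eqF (ltnW hn)) /= !addr0 mulr0.
  by move/eqP; rewrite oner_eq0.
- move=> a u v /asboolP[q ->] /asboolP[r ->]; apply/asboolP.
  by exists (a * q + r); rewrite mulrDl mulrA.
Qed.

HB.instance Definition _ :=
  isIdealr.Build {mpoly k[3]} (fermat_ideal hm hn) fermat_ideal_closed.

Definition ringS : comNzRingType := {ideal_quot (fermat_ideal hm hn)}.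

Definition toS (p : {mpoly k[3]}) : ringS :=
  \pi_({ideal_quot (fermat_ideal hm hn)}) p.

Definition S_graded (d : nat) : {pred ringS} :=
  [pred x | `[< exists2 p, p \in whomog wtS d & x = toS p >]].

Definition T_to_S (p : {mpoly k[2]}) : ringS := toS (mwiden p).

End FermatHypersurface.

Arguments fermat_poly k m n : clear implicits.
Arguments T_graded k n d : clear implicits.
Arguments ringS k {m n} hm hn.
Arguments toS k {m n} hm hn p.
Arguments T_to_S k {m n} hm hn p.
Arguments S_graded k {m n} hm hn d.

(* Main.v *)
Require Import Defs.
From HB Require Import structures.
From mathcomp Require Import all_boot all_order all_algebra.
From mathcomp Require Import boolp classical_sets fsbigop.
From mathcomp Require Import freeg mpoly ring zify.

Set Implicit Arguments.
Unset Strict Implicit.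
Unset Printing Implicit Defensive.

Import GRing.Theory.
Local Open Scope ring_scope.
Local Open Scope quotient_scope.

(** Since gcd(m, n) = 1, a homogeneous element of S has the form t Y^c with t a
form in X_1, X_2, so its n-th power is a form in X_1, X_2, which splits into
linear forms because k is algebraically closed.

A prime P of R of coheight 1 that contains a nonzero homogeneous element is
homogeneous, contains exactly one linear form l up to scalars, and is the only
prime of coheight 1 containing l. Hence div(l) = e [P], where e is positive and
bounded by the rank of R over k[X_1, X_2].

If P contains no nonzero homogeneous element, then Euclidean division with
respect to the width of the range of degrees shows that P is generated by one
element x up to homogeneous denominators. Hence div(x) - [P] is a combination
of homogeneous primes, which are torsion by the first case. *)

(** * Chains of prime ideals and coheight *)

(** Working up to torsion leaves room for crude counts: for [[R/P]] to be torsion it suffices to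
    find one [x] in [P] whose divisor has a positive coefficient at [P] and otherwise involves only
    primes already known to be torsion. The coefficient needs no exact value, but it must come from
    a finite length, because [mod_length] is 0 on infinite lengths and a divisor with coefficient 0
    at [P] says nothing. This is why both kinds of primes require a bound on chains of submodules.

    The ring [R] is only known to lie between [T] and [S], so its structure is extracted by hand
    from the embedding in [S]. Absence of zero divisors follows from n-th powers of homogeneous
    elements being forms; finite lengths follow from any [n + 1] elements being linearly dependent
    over [T]; the bound 2 on chains of primes follows from algebraic dependence of four polynomials
    in three variables. Together with an explicit chain of length 2, this gives the zero ideal
    coheight 2, so that principal divisors on [R] itself are relators for 1-cycles. *)

Section Spectrum.
Variable A : comNzRingType.
Implicit Types (P Q : spec A) (x y : A).

Lemma spec_of_predicate (I : A -> Prop) :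
    I 0 -> ~ I 1 -> (forall a x y, I x -> I y -> I (a * x + y)) ->
    (forall x y, I (x * y) -> I x \/ I y) ->
  exists P : spec A, forall x, x \in spec_set P <-> I x.
Proof.
move=> I0 I1 Ilin IM; pose p : A -> bool := fun x => `[< I x >].
have hp : `[< idealr_closed p /\ prime_idealr_closed p >].
  apply/asboolP; split; first split.
  - by apply/asboolP.
  - by apply/negP => /asboolP.
  - move=> a x y /asboolP Ix /asboolP Iy; by apply/asboolP/Ilin.
  - by move=> x y /asboolP/IM[] h; apply/orP; [left|right]; apply/asboolP.
by exists (exist _ p hp) => x; split=> [/asboolP//|Ix]; apply/asboolP.
Qed.

Lemma spec_inj P Q : {subset spec_set P <= spec_set Q} ->
  {subset spec_set Q <= spec_set P} -> P = Q.
Proof.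
move=> PQ QP; apply: val_inj; apply: funext => x /=.
by apply/idP/idP; [exact: PQ | exact: QP].
Qed.

Lemma specMr P x y : x \in spec_set P -> x * y \in spec_set P.
Proof. by rewrite mulrC; exact: idealMr. Qed.

Lemma spec1 P : 1 \in spec_set P -> False.
Proof. by rewrite (idealr1 (prime_of_spec P)). Qed.

Lemma specM P x y : x * y \in spec_set P = (x \in spec_set P) || (y \in spec_set P).
Proof. exact: (prime_idealrM (prime_of_spec P)). Qed.

Lemma specX P x n : (0 < n)%N -> x ^+ n \in spec_set P = (x \in spec_set P).
Proof.
case: n => // n _; elim: n => [|n IH]; first by rewrite expr1.
by rewrite exprS specM IH orbb.
Qed.

Lemma spec_prod (I : Type) (r : seq I) (F : I -> A) P :
  \prod_(s <- r) F s \in spec_set P -> has (fun s => F s \in spec_set P) r.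
Proof.
elim: r => [|s r IH]; first by rewrite big_nil => /spec1.
by rewrite big_cons specM /= => /orP[->//|/IH ->]; rewrite orbT.
Qed.

End Spectrum.

(** * Coheight in terms of primes above [P] *)

Section Coheight.
Variable A : comNzRingType.
Implicit Types (P Q : spec A) (x y : A).

(** The chain may start strictly above [P]: this matches chains in the quotient by [P] and makes the
    notion monotone in [P]. *)
Definition chain_above P n := exists c : nat -> spec A,
  {subset spec_set P <= spec_set (c 0%N)} /\
  forall i, (i < n)%N -> proper_subset (spec_set (c i)) (spec_set (c i.+1)).

Lemma pi_ideal_eq0 P x :
  (\pi_({ideal_quot (prime_of_spec P)}) x == 0) = (x \in spec_set P).
Proof. by rewrite -[x in RHS]subr0 Quotient.idealrBE rmorph0. Qed.

Lemma contract_spec P (J : spec {ideal_quot (prime_of_spec P)}) :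
  exists2 Q : spec A, {subset spec_set P <= spec_set Q} &
    forall x, x \in spec_set Q <-> \pi_({ideal_quot (prime_of_spec P)}) x \in spec_set J.
Proof.
pose I x : Prop := \pi_({ideal_quot (prime_of_spec P)}) x \in spec_set J.
have [||||Q hQ] := @spec_of_predicate A I; rewrite /I.
- by rewrite rmorph0 rpred0.
- by rewrite rmorph1 => /spec1.
- by move=> a x y hx hy; rewrite rmorphD rmorphM rpredD // idealMr.
- by move=> x y; rewrite rmorphM specM => /orP.
exists Q => // x; rewrite -pi_ideal_eq0 => /eqP x0; apply/hQ.
by rewrite /I x0 rpred0.
Qed.

Lemma extend_spec P Q : {subset spec_set P <= spec_set Q} ->
  exists J : spec {ideal_quot (prime_of_spec P)},
    forall x, \pi_({ideal_quot (prime_of_spec P)}) x \in spec_set J <-> x \in spec_set Q.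
Proof.
move=> PQ; pose I (z : {ideal_quot (prime_of_spec P)}) : Prop :=
  exists2 x, z = \pi x & x \in spec_set Q.
have Ipi x : I (\pi x) <-> x \in spec_set Q.
  split=> [[y /eqP e yQ]|]; last by exists x.
  rewrite -(subrK y x) rpredD //; apply: PQ.
  by rewrite -pi_ideal_eq0 rmorphB subr_eq0.
have [||||J hJ] := @spec_of_predicate _ I.
- by exists 0; rewrite ?rmorph0 ?rpred0.
- rewrite -[1](rmorph1 (\pi_({ideal_quot (prime_of_spec P)}))) => /Ipi; exact: spec1.
- move=> a _ _ [x -> xQ] [y -> yQ]; exists (repr a * x + y).
    by rewrite -[a in LHS]reprK rmorphD rmorphM.
  by rewrite rpredD // idealMr.
- move=> a b; rewrite -[a]reprK -[b]reprK -rmorphM => /Ipi.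
  by rewrite specM => /orP[] h; [left|right]; apply/Ipi.
by exists J => x; split=> [/hJ/Ipi //|/Ipi/hJ].
Qed.

Lemma quot_has_chainP P n :
  has_chain (@spec_set {ideal_quot (prime_of_spec P)}) n <-> chain_above P n.
Proof.
split=> [[c hc]|[c [Pc hc]]].
  have /choice[d hd] : forall i, exists Q : spec A, {subset spec_set P <= spec_set Q} /\
      forall x, x \in spec_set Q <-> \pi x \in spec_set (c i).
    by move=> i; have [Q] := contract_spec (c i); exists Q.
  exists d; split=> [|i lt_in]; first by case: (hd 0%N).
  have [sub nsub] := hc _ lt_in; have [_ h1] := hd i; have [_ h2] := hd i.+1.
  split=> [x /h1 /sub /h2 //|dsub]; apply: nsub => z; rewrite -[z]reprK.
  by move=> /h2 /dsub /h1.
(* [c] is constrained only up to index [n]; truncating the index gives a prime above [P] at every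
   [i], as [choice] requires. *)
have Pc' i : {subset spec_set P <= spec_set (c (minn i n))}.
  have : (minn i n <= n)%N by rewrite geq_minr.
  elim: (minn i n) => [//|s IH] ltsn x xP.
  by have [+ _] := hc _ ltsn; apply; apply: IH xP; exact: ltnW.
have /choice[d hd] := fun i => extend_spec (Pc' i).
exists d => i lt_in; have [] := hc _ lt_in.
have := hd i; have := hd i.+1; rewrite (minn_idPl lt_in) (minn_idPl (ltnW lt_in)).
move=> h2 h1 sub nsub; split=> [z|dsub].
  by rewrite -[z]reprK => /h1 /sub /h2.
by apply: nsub => x /h2 /dsub /h1.
Qed.

Lemma chain_above_trans P Q n : {subset spec_set P <= spec_set Q} ->
  chain_above Q n -> chain_above P n.
Proof. by move=> PQ [c [Qc hc]]; exists c; split=> // x /PQ /Qc. Qed.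

Lemma chain_above_cons P Q n : proper_subset (spec_set P) (spec_set Q) ->
  chain_above Q n -> chain_above P n.+1.
Proof.
move=> [PQ nPQ] [c [Qc hc]].
exists (fun i => if i is i'.+1 then c i' else P); split=> // -[|i] /= hi.
  by split=> [x /PQ /Qc //|cP]; apply: nPQ => x /Qc /cP.
exact: hc.
Qed.

Lemma chain_above0 P : chain_above P 0.
Proof. by exists (fun=> P); split=> // x. Qed.

Lemma has_coheightP P d : has_coheight P d <->
  chain_above P d /\ forall n, chain_above P n -> (n <= d)%N.
Proof.
split=> -[h1 h2]; split.
- exact: (iffLR (quot_has_chainP _ _)).
- by move=> n /(iffRL (quot_has_chainP _ _)) /h2.
- exact: (iffRL (quot_has_chainP _ _)).
- by move=> n /(iffLR (quot_has_chainP _ _)) /h2.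
Qed.

Lemma coheight1_proper_above P : has_coheight P 1 ->
  exists Q, proper_subset (spec_set P) (spec_set Q).
Proof.
move=> /has_coheightP[[c [Pc hc]] _]; exists (c 1%N).
have [sub nsub] := hc _ (ltn0Sn 0); split=> [x /Pc /sub //|cP].
by apply: nsub => x /cP /Pc.
Qed.

(** A strict inclusion of [P] in [Q], prolonged by a prime strictly above [Q], would be a chain of
    length 2 above [P]. *)
Lemma coheight1_eq P Q : has_coheight P 1 -> has_coheight Q 1 ->
  {subset spec_set P <= spec_set Q} -> P = Q.
Proof.
move=> hP hQ PQ; have [//|nQP] := pselect (P = Q).
have nsub : ~ {subset spec_set Q <= spec_set P} by move=> ?; apply: nQP; exact: spec_inj.
have /has_coheightP[_ /(_ 2%N)] := hP.
have [Q' QQ'] := coheight1_proper_above hQ.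
have chQ := chain_above_cons QQ' (chain_above0 Q').
by move=> /(_ (chain_above_cons (conj PQ nsub) chQ)).
Qed.

End Coheight.

(** * Krull dimension at most 2 *)

(* Dividing a relation by the largest possible power of x leaves a relation
   whose constant coefficient lies in every ideal J that contains x and I. *)
Lemma lowest_coef_in_ideal (R : comNzRingType) (I J : R -> Prop) (x : R) e
    (nz : pred 'I_e) (g : 'I_e -> R) (a0 : 'I_e) :
    (forall y, I (x * y) -> I y) -> (forall y, I y -> J y) ->
    J 0 -> (forall a u v, J u -> J v -> J (a * u + v)) -> J x ->
    (forall a, ~~ nz a -> g a = 0) -> nz a0 -> I (\sum_a g a * x ^+ a) ->
  exists2 a, nz a & J (g a).
Proof.
move=> Ix IJ J0 Jlin Jx g0 nza0.
have [a1 nza1 mina1] := arg_minnP (fun a : 'I_e => nat_of_ord a) nza0.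
have -> : \sum_a g a * x ^+ a = x ^+ a1 * \sum_a g a * x ^+ (a - a1).
  rewrite mulr_sumr; apply: eq_bigr => a _; case: (boolP (nz a)) => [nza|/g0->].
    by rewrite mulrCA -exprD subnKC // mina1.
  by rewrite !mul0r mulr0.
move=> Isum; exists a1 => //.
have {}Isum : J (\sum_a g a * x ^+ (a - a1)).
  apply: IJ; elim: (nat_of_ord a1) (\sum_a _ * _) Isum => [|s IH] y.
    by rewrite expr0 mul1r.
  by rewrite exprS -mulrA => /Ix /IH.
have Jrest : J (\sum_(a | a != a1) g a * x ^+ (a - a1)).
  apply: (big_ind J) => // [u v Ju Jv|a neq_a]; first by rewrite -[u]mul1r; exact: Jlin.
  case: (boolP (nz a)) => [nza|/g0->]; last by rewrite mul0r.
  have lt_a : (a1 < a)%N by rewrite ltn_neqAle eq_sym neq_a mina1.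
  by rewrite -(subnSK lt_a) exprSr mulrA -[_ * _]addr0; exact: Jlin.
move: Isum; rewrite (bigD1 a1) //= subnn expr0 mulr1 => Jsum.
by rewrite (_ : g a1 = (-1) * (\sum_(a | a != a1) g a * x ^+ (a - a1)) +
  (g a1 + \sum_(a | a != a1) g a * x ^+ (a - a1))); [exact: Jlin | ring].
Qed.

(** Only monomials with all exponents below [D] occur. There are [D ^ N] of them, so the matrix of
    coefficients has more rows than columns and a nonzero left kernel. *)
Lemma mpoly_family_dependent (k : fieldType) (N D : nat) (I : finType)
    (q : I -> {mpoly k[N]}) :
    (forall s, (msize (q s) <= D)%N) -> (D ^ N < #|I|)%N ->
  exists2 h : I -> k, (exists s, h s != 0) & \sum_s h s *: q s = 0.
Proof.
move=> qD; pose J := {ffun 'I_N -> 'I_D}.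
pose mon (f : J) : 'X_{1..N} := [multinom nat_of_ord (f s) | s < N].
move=> ltI; pose M : 'M[k]_(#|I|, #|J|) :=
  \matrix_(s, t) (q (enum_val s))@_(mon (enum_val t)).
have : kermx M != 0.
  rewrite kermx_eq0 /row_free neq_ltn (leq_ltn_trans (rank_leq_col M)) //.
  by rewrite card_ffun !card_ord.
case/rowV0Pn=> v /sub_kermxP vM0 v_neq0.
exists (fun s => v ord0 (enum_rank s)).
  have /existsP[s vs] : [exists s, v ord0 s != 0].
    apply: contraR v_neq0; rewrite negb_exists => /forallP v0.
    by apply/eqP/rowP => s; rewrite mxE; apply/eqP/negPn.
  by exists (enum_val s); rewrite enum_valK.
apply/mpolyP => m; rewrite mcoeff0 raddf_sum /=.
have [ltm|gem] := boolP [forall s : 'I_N, m s < D]%N; last first.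
  rewrite big1 // => s _; rewrite mcoeffZ memN_msupp_eq0 ?mulr0 //.
  apply: contra gem => ms; apply/forallP => t; apply: leq_trans (qD s).
  apply: leq_ltn_trans (msize_mdeg_lt ms).
  by rewrite mdegE (bigD1 t) //= leq_addr.
pose f : J := [ffun s => Ordinal (forallP ltm s)].
have mE : m = mon f by apply/mnmP => s; rewrite mnmE ffunE.
have /rowP/(_ (enum_rank f)) := vM0.
rewrite !mxE (reindex enum_rank) /=; last first.
  by exists enum_val => s _; rewrite ?enum_rankK ?enum_valK.
move=> sum0; rewrite -[RHS]sum0; apply: eq_bigr => s _.
by rewrite mcoeffZ mxE !enum_rankK mE.
Qed.

Lemma msizeM_leS (k : fieldType) N (p q : {mpoly k[N]}) a b :
  (msize p <= a.+1)%N -> (msize q <= b.+1)%N -> (msize (p * q) <= (a + b).+1)%N.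
Proof.
have [->|p0] := eqVneq p 0; first by rewrite mul0r mmeasure0.
have [->|q0] := eqVneq q 0; first by rewrite mulr0 mmeasure0.
by move=> hp hq; rewrite msizeM // -subn1 leq_subLR add1n -addSn -addnS leq_add.
Qed.

Lemma msizeX_le (k : fieldType) N (p : {mpoly k[N]}) d a :
  (msize p <= d.+1)%N -> (msize (p ^+ a) <= (a * d).+1)%N.
Proof.
move=> pd; elim: a => [|a IH]; first by rewrite expr0 msize1.
by rewrite exprS mulSn; apply: msizeM_leS.
Qed.

(* There are e ^ 4 monomials of degree < e in each of the four polynomials, and
   their values lie in a space of dimension O(e ^ 3). *)
Lemma mpoly3_algebraic_dependence (k : fieldType) (p0 p1 p2 p3 : {mpoly k[3]}) :
  exists e (h : 'I_e -> 'I_e -> 'I_e -> 'I_e -> k),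
    (exists a b c d, h a b c d != 0) /\
    \sum_a (\sum_b (\sum_c (\sum_d (h a b c d)%:MP * p3 ^+ d) * p2 ^+ c)
      * p1 ^+ b) * p0 ^+ a = 0.
Proof.
pose d := (msize p0 + msize p1 + msize p2 + msize p3)%N.
(* The products have size at most [4 * e * d + 1], and [(4 * e * d + 1) ^ 3 <= e ^ 3 * (4 * d + 1) ^
   3 < e ^ 4] by this choice of [e]. *)
pose e := ((4 * d + 1) ^ 3).+1.
pose I : finType := ('I_e * ('I_e * ('I_e * 'I_e)))%type.
pose q (s : I) := p0 ^+ s.1 * (p1 ^+ s.2.1 * (p2 ^+ s.2.2.1 * p3 ^+ s.2.2.2)).
have [||h [[a [b [c z]]] nzh] h0] := @mpoly_family_dependent k 3 (4 * e * d + 1) I q.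
- move=> [[a lta] [[b ltb] [[c ltc] [z ltz]]]]; rewrite /q /=.
  have h0 : (msize (p0 ^+ a) <= (a * d).+1)%N by apply: msizeX_le; lia.
  have h1 : (msize (p1 ^+ b) <= (b * d).+1)%N by apply: msizeX_le; lia.
  have h2 : (msize (p2 ^+ c) <= (c * d).+1)%N by apply: msizeX_le; lia.
  have h3 : (msize (p3 ^+ z) <= (z * d).+1)%N by apply: msizeX_le; lia.
  have := msizeM_leS h0 (msizeM_leS h1 (msizeM_leS h2 h3)).
  move/leq_trans; apply; nia.
- rewrite !card_prod !card_ord.
  apply: (@leq_ltn_trans (e ^ 3 * (4 * d + 1) ^ 3)%N).
    by rewrite -expnMn leq_exp2r //; have : (0 < e)%N by []; nia.
  have -> : (e * (e * (e * e)) = e ^ 3 * e)%N by rewrite -expnSr.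
  by rewrite ltn_mul2l expn_gt0 /= ltnSn.
exists e, (fun a b c z => h (a, (b, (c, z)))); split; first by exists a, b, c, z.
clear nzh a b c z.
rewrite -[RHS]h0; under [RHS]eq_bigr => s _.
  have -> : h s *: q s = (fun a t => h (a, t) *: q (a, t)) s.1 s.2 by case: s.
  over.
rewrite -(pair_bigA _ (fun a t => h (a, t) *: q (a, t))) /=.
apply: eq_bigr => a _; rewrite mulr_suml.
under [RHS]eq_bigr => s _.
  have -> : h (a, s) *: q (a, s) = (fun b t => h (a, (b, t)) *: q (a, (b, t))) s.1 s.2.
    by case: s.
  over.
rewrite -(pair_bigA _ (fun b t => h (a, (b, t)) *: q (a, (b, t)))) /=.
apply: eq_bigr => b _; rewrite !mulr_suml.
under [RHS]eq_bigr => s _.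
  have -> : h (a, (b, s)) *: q (a, (b, s)) =
    (fun c t => h (a, (b, (c, t))) *: q (a, (b, (c, t)))) s.1 s.2 by case: s.
  over.
rewrite -(pair_bigA _ (fun c t => h (a, (b, (c, t))) *: q (a, (b, (c, t))))) /=.
apply: eq_bigr => c _; rewrite !mulr_suml; apply: eq_bigr => z _.
by rewrite /q /= -mul_mpolyC; ring.
Qed.

(** In a chain of length 3, pick [x1], [x2], [x3], each in one prime but not in the preceding one,
    and lift them to polynomials. These and [f] satisfy a nontrivial algebraic relation. Stripping
    [f], then [x1], [x2], [x3] by [lowest_coef_in_ideal] moves the relation up one prime at a time,
    until a nonzero scalar lies in the last prime. *)
Lemma chain_length_le2 (k : fieldType) (R S : comNzRingType) (f : {mpoly k[3]})
    (pr : {rmorphism {mpoly k[3]} -> S}) (j : {rmorphism R -> S})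
    (th : k -> R) (c : nat -> spec R) n :
    injective j -> (forall a, j (th a) = pr a%:MP) -> (forall s, exists p, pr p = s) ->
    f != 0 -> (forall p, pr p = 0 <-> exists q, p = q * f) ->
    (forall i, (i < n)%N -> proper_subset (spec_set (c i)) (spec_set (c i.+1))) ->
  (n <= 2)%N.
Proof.
move=> j_inj jth pr_surj f_neq0 pr0 hc; rewrite leqNgt; apply/negP => lt2n.
have {}hc i : (i < 3)%N -> proper_subset (spec_set (c i)) (spec_set (c i.+1)).
  by move=> lti; apply: hc; lia.
have pick i : (i < 3)%N -> exists x, x \in spec_set (c i.+1) /\ x \notin spec_set (c i).
  move=> /hc[_ nsub]; apply: contrapT => nex; apply: nsub => x xi.
  by apply: contrapT => /negP xout; apply: nex; exists x.
have [x1 [x1in x1out]] := pick 0%N isT.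
have [x2 [x2in x2out]] := pick 1%N isT.
have [x3 [x3in x3out]] := pick 2%N isT.
have [p1 p1E] := pr_surj (j x1); have [p2 p2E] := pr_surj (j x2).
have [p3 p3E] := pr_surj (j x3).
have [e [h [[a0 [b0 [c0 [d0 nzh]]]] rel]]] := mpoly3_algebraic_dependence f p1 p2 p3.
have spec_lin i a u v : u \in spec_set (c i) -> v \in spec_set (c i) ->
    a * u + v \in spec_set (c i).
  by move=> ui vi; rewrite rpredD // idealMr.
have [|||||a|||a /existsP[b1 /existsP[c1 /existsP[d1 nzh1]]]] := @lowest_coef_in_ideal _
    (fun p => p = 0) (fun p => pr p = 0) f e
    (fun a => [exists b, exists c, exists d, h a b c d != 0])
    (fun a => \sum_b (\sum_c (\sum_d (h a b c d)%:MP * p3 ^+ d) * p2 ^+ c) * p1 ^+ b) a0.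
- by move=> y /eqP; rewrite mulf_eq0 (negPf f_neq0) => /eqP.
- by move=> _ ->; rewrite rmorph0.
- exact: rmorph0.
- by move=> a u v u0 v0; rewrite rmorphD rmorphM u0 v0 mulr0 addr0.
- by apply/pr0; exists 1; rewrite mul1r.
- rewrite negb_exists => /forallP h0; apply: big1 => b _.
  rewrite big1 ?mul0r // => z _; rewrite big1 ?mul0r // => t _.
  have := h0 b; rewrite negb_exists => /forallP/(_ z).
  by rewrite negb_exists => /forallP/(_ t); rewrite negbK => /eqP->; rewrite mul0r.
- by apply/existsP; exists b0; apply/existsP; exists c0; apply/existsP; exists d0.
- exact: rel.
move=> rel1.
(* Modulo [f] the relation is one between the images of the [x]'s in [S], and injectivity of [j]
   brings it back to [R]. *)
have {}rel1 : \sum_b (\sum_c (\sum_d th (h a b c d) * x3 ^+ d) * x2 ^+ c) * x1 ^+ b = 0.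
  apply: j_inj; rewrite rmorph0 -{}rel1 !rmorph_sum; apply: eq_bigr => b _.
  rewrite !rmorphM !rmorphXn p1E !rmorph_sum; congr (_ * _); apply: eq_bigr => z _.
  rewrite !rmorphM !rmorphXn p2E !rmorph_sum; congr (_ * _); apply: eq_bigr => t _.
  by rewrite !rmorphM !rmorphXn p3E /= jth.
have [|||||b|||b /existsP[c2 /existsP[d2 nzh2]]] := @lowest_coef_in_ideal _
    (fun x => x \in spec_set (c 0)) (fun x => x \in spec_set (c 1)) x1 e
    (fun b => [exists c, exists d, h a b c d != 0])
    (fun b => \sum_c (\sum_d th (h a b c d) * x3 ^+ d) * x2 ^+ c) b1.
- by move=> y; rewrite specM (negPf x1out).
- by have [sub _] := hc 0%N isT; move=> y /sub.
- exact: rpred0.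
- exact: spec_lin.
- exact: x1in.
- rewrite negb_exists => /forallP h0.
  rewrite big1 // => z _; rewrite big1 ?mul0r // => t _.
  have := h0 z; rewrite negb_exists => /forallP/(_ t).
  rewrite negbK => /eqP->; apply: j_inj.
  by rewrite rmorphM jth mpolyC0 !rmorph0 mul0r.
- by apply/existsP; exists c1; apply/existsP; exists d1.
- by rewrite rel1 rpred0.
move=> rel2.
have [|||||z||z /existsP[d3 nzh3]] := @lowest_coef_in_ideal _
    (fun x => x \in spec_set (c 1)) (fun x => x \in spec_set (c 2)) x2 e
    (fun z => [exists d, h a b z d != 0])
    (fun z => \sum_d th (h a b z d) * x3 ^+ d) c2 _ _ _ _ _ _ _ rel2.
- by move=> y; rewrite specM (negPf x2out).
- by have [sub _] := hc 1%N isT; move=> y /sub.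
- exact: rpred0.
- exact: spec_lin.
- exact: x2in.
- rewrite negb_exists => /forallP h0; rewrite big1 // => t _.
  have := h0 t; rewrite negbK => /eqP->; apply: j_inj.
  by rewrite rmorphM jth mpolyC0 !rmorph0 mul0r.
- by apply/existsP; exists d2.
move=> rel3.
have [|||||t||t nzh4] := @lowest_coef_in_ideal _
    (fun x => x \in spec_set (c 2)) (fun x => x \in spec_set (c 3)) x3 e
    (fun t => h a b z t != 0) (fun t => th (h a b z t)) d3 _ _ _ _ _ _ _ rel3.
- by move=> y; rewrite specM (negPf x3out).
- by have [sub _] := hc 2%N isT; move=> y /sub.
- exact: rpred0.
- exact: spec_lin.
- exact: x3in.
- rewrite negbK => /eqP->; apply: j_inj.
  by rewrite jth mpolyC0 !rmorph0.
- exact: nzh3.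
move=> /(idealMr (th (h a b z t)^-1)).
rewrite (_ : _ * _ = 1); first exact: spec1.
by apply: j_inj; rewrite rmorphM !jth -rmorphM -mpolyCM mulVf // mpolyC1 !rmorph1.
Qed.

(** * Lengths of localized cyclic modules *)

Lemma max_chain_uniq (T X : Type) (set_of : X -> {pred T}) d e :
  max_chain set_of d -> max_chain set_of e -> d = e.
Proof.
by move=> [cd dmax] [ce emax]; apply/eqP; rewrite eqn_leq emax // dmax.
Qed.

Lemma mod_lengthE (A : pzRingType) (M : lmodType A) l :
  has_length M l -> mod_length M = l.
Proof. by move=> Ml; apply: xget_unique => // l' Ml'; exact: (max_chain_uniq Ml' Ml). Qed.

(** The bound [N] makes the supremum of chain lengths exist, so that [mod_length] is not the default
    0. *)
Lemma mod_length_gt0 (A : pzRingType) (M : lmodType A) N :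
    (forall n, has_chain (fun N : submodClosed M => N : {pred M}) n -> (n <= N)%N) ->
  has_chain (fun N : submodClosed M => N : {pred M}) 1 -> (0 < mod_length M)%N.
Proof.
move=> bound chain1.
have ex : exists n, `[< has_chain (fun N : submodClosed M => N : {pred M}) n >].
  by exists 1%N; apply/asboolP.
have ub n : `[< has_chain (fun N : submodClosed M => N : {pred M}) n >] -> (n <= N)%N.
  by move=> /asboolP /bound.
case: (ex_maxnP ex ub) => l /asboolP chl lmax.
rewrite (@mod_lengthE _ _ l); last by split=> // n chn; apply: lmax; apply/asboolP.
by apply: lmax; apply/asboolP.
Qed.

Section LocalLength.
Variables (R : comNzRingType) (Q P : spec R) (x : R).
Hypothesis Q0 : forall y, y \in spec_set Q -> y = 0.

Local Notation RQ := (mod_quot (ideal_set Q)).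
Local Notation M := (mod_quot (@multiples R RQ x)).
Local Notation L := (loc_mod P M : lmodType (loc_ring P)).
Local Notation chain n := (has_chain (fun N : submodClosed L => N : {pred L}) n).

(** As [Q] is zero, this map has kernel [xR] (see [q_eq0]), so the nested quotient types amount to
    [R/xR]. *)
Let q (a : R) : M :=
  \pi_(@Quotient.quot _ (submod_set (@multiples R RQ x)))
    (\pi_(@Quotient.quot _ (submod_set (ideal_set Q))) a : RQ).

Let qZ a b : q (a * b) = a *: q b.
Proof. by rewrite /q -!mod_quot_scaleE. Qed.

Let qD a b : q (a + b) = q a + q b.
Proof. by rewrite /q !raddfD. Qed.

Let q_surj m : exists a, m = q a.
Proof.
exists (repr (repr (m : @Quotient.quot _ (submod_set (@multiples R RQ x)))
   : @Quotient.quot _ (submod_set (ideal_set Q)))).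
by rewrite /q !reprK.
Qed.

Let q_eq0 a : q a = 0 <-> exists y, a = x * y.
Proof.
rewrite /q -(raddf0 (\pi_(@Quotient.quot _ (submod_set (@multiples R RQ x))))).
split=> [/eqP|[y ->]].
  rewrite -Quotient.idealrBE subr0 => /(elimT (asboolP _))[w].
  rewrite -[w](@reprK _ (@Quotient.quot _ (submod_set (ideal_set Q)))).
  rewrite -[_ *: _]mod_quot_scaleE => /eqP; rewrite -Quotient.idealrBE => /Q0 /eqP.
  by rewrite subr_eq0 => /eqP ->; eexists; reflexivity.
apply: (elimT (@eqP (@Quotient.quot _ (submod_set (@multiples R RQ x))) _ _)).
rewrite -Quotient.idealrBE subr0; apply: (introT (asboolP _)).
exists (\pi_(@Quotient.quot _ (submod_set (ideal_set Q))) y).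
rewrite -[x * y]/(x *: (y : R^o)); symmetry; exact: mod_quot_scaleE.
Qed.

Let la (a : R) (s : denom P) : L := Defs.frac (q a) s.

Let la_surj v : exists a s, v = la a s.
Proof. by have [m [s ->]] := fracP v; have [a ->] := q_surj m; exists a, s. Qed.

Let laD a b : la (a + b) (denom1 P) = la a (denom1 P) + la b (denom1 P).
Proof.
rewrite /la qD fracD; apply: frac_eq.
by rewrite !denM !den1 !mulr1 !scale1r.
Qed.

Let laM (b : R) (s : denom P) a t :
  (Defs.frac (b : R^o) s : loc_ring P) *: la a t = la (b * a) (denomM s t).
Proof. by rewrite /la qZ; exact: loc_scaleE. Qed.

(** Denominators are units of [R_P], so membership in a submodule depends on the numerator alone. *)
Let la_den (N : submodClosed L) a s :
  (la a s \in (N : {pred L})) = (la a (denom1 P) \in (N : {pred L})).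
Proof.
apply/idP/idP => h.
  have -> : la a (denom1 P) = (Defs.frac (den s : R^o) (denom1 P) : loc_ring P) *: la a s.
    rewrite laM /la; apply: frac_eq.
    by rewrite denM den1 mul1r scale1r qZ.
  exact: rpredZ.
have -> : la a s = (Defs.frac (1 : R^o) s : loc_ring P) *: la a (denom1 P).
  rewrite laM /la; apply: frac_eq.
  by rewrite denM den1 mulr1 mul1r.
exact: rpredZ.
Qed.

Let la_sat (N : submodClosed L) a t : t \notin spec_set P ->
  la (t * a) (denom1 P) \in (N : {pred L}) -> la a (denom1 P) \in (N : {pred L}).
Proof.
move=> tP; pose s : denom P := exist _ t tP.
suff -> : la a (denom1 P) = (Defs.frac (1 : R^o) s : loc_ring P) *: la (t * a) (denom1 P).
  exact: rpredZ.
rewrite laM /la; apply: frac_eq.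
by rewrite denM !den1 mulr1 mul1r scale1r qZ.
Qed.

Let la_multiple y : la (x * y) (denom1 P) = 0.
Proof.
apply/frac_eqP; exists (denom1 P); rewrite !den1 !scale1r.
by apply/q_eq0; exists y.
Qed.

Let la1_eq0 : la 1 (denom1 P) = 0 -> exists2 u, u \notin spec_set P & exists y, u = x * y.
Proof.
move=> /frac_eqP[u]; rewrite !den1 !scale1r scaler0 -qZ mulr1 => /q_eq0 ux.
by exists (den u) => //; exact: (svalP u).
Qed.

(** Submodules of the localization of [R/xR] pull back to ideals of [R] that contain [x] and are
    saturated with respect to the complement of [P]. Lengths can then be bounded inside [R]. *)
Lemma chain_of_ideals n : chain n ->
  exists J : nat -> R -> Prop,
    (forall i, [/\ J i 0, forall a u v, J i u -> J i v -> J i (a * u + v),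
                 forall y, J i (x * y) &
                 forall s a, s \notin spec_set P -> J i (s * a) -> J i a]) /\
    (forall i, (i < n)%N -> (forall a, J i a -> J i.+1 a) /\
       exists2 a, J i.+1 a & ~ J i a).
Proof.
move=> [c hc]; exists (fun i a => la a (denom1 P) \in (c i : {pred L})); split=> i.
  split=> [|a u v hu hv|y|s a sP].
  - by have := la_multiple 0; rewrite mulr0 => ->; exact: rpred0.
  - rewrite laD rpredD //.
    have -> : la (a * u) (denom1 P) =
        (Defs.frac (a : R^o) (denom1 P) : loc_ring P) *: la u (denom1 P).
      rewrite laM /la; apply: frac_eq.
      by rewrite denM !den1 mulr1.
    exact: rpredZ.
  - by rewrite la_multiple rpred0.
  - exact: la_sat.
move=> /hc[sub nsub]; split=> [a /sub //|].
apply: contrapT => nex; apply: nsub => v; have [a [s ->]] := la_surj v.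
rewrite !la_den => h; apply: contrapT => nh; apply: nex.
by exists a.
Qed.

(** Here [x] is a unit of [R_P]: a saturated ideal containing [x * a] contains [a], so no inclusion
    can be strict. *)
Lemma loc_length_cyclic0 : x \notin spec_set P -> loc_length P M = 0%N.
Proof.
move=> xP; apply: mod_lengthE; split.
  by exists (fun=> @multiples (loc_ring P) L 0 : submodClosed L).
move=> [//|n] /chain_of_ideals[J [J1 J2]].
have [_ [a _ []]] := J2 0%N isT.
by have [_ _ /(_ a) h /(_ _ _ xP)] := J1 0%N; apply.
Qed.

Lemma loc_length_cyclic_gt0 N : x \in spec_set P ->
  (forall n, chain n -> (n <= N)%N) -> (0 < loc_length P M)%N.
Proof.
move=> xP bound; apply: (mod_length_gt0 bound).
(* For [i] equal to 0 and 1 these are the zero submodule and all of [L]. They differ because a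
   fraction 1/1 equal to zero would give a multiple of [x] outside [P]. *)
exists (fun i => @multiples (loc_ring P) L i%:R : submodClosed L) => -[|//] _; split=> [v|sub].
  by move=> /asboolP[w ->]; apply/asboolP; exists 0; rewrite scale0r scaler0.
have : la 1 (denom1 P) \in (@multiples (loc_ring P) L 1%:R : {pred L}).
  by apply/asboolP; exists (la 1 (denom1 P)); rewrite scale1r.
move=> /sub /asboolP[w]; rewrite scale0r => /la1_eq0[u uP [y uE]].
by move: uP; rewrite uE specMr.
Qed.

End LocalLength.

(** * Torsion in Chow groups *)

Section TorsionModulo.
Variables (V : zmodType) (H : zmodClosed V).

(** Torsion of the class of [v] in the quotient by [H], expressed on representatives. *)
Definition torsion_mod (v : V) : Prop := exists2 N, (0 < N)%N & v *+ N \in H.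

Lemma torsion_modD u v : torsion_mod u -> torsion_mod v -> torsion_mod (u + v).
Proof.
move=> [M M0 uM] [N N0 vN]; exists (M * N)%N; first by rewrite muln_gt0 M0.
rewrite mulrnDl; apply: rpredD; first by rewrite mulrnA; exact: rpredMn.
by rewrite mulnC mulrnA; exact: rpredMn.
Qed.

Lemma torsion_mod0 : torsion_mod 0.
Proof. by exists 1%N; rewrite ?mul0rn ?rpred0. Qed.

Lemma torsion_modN v : torsion_mod v -> torsion_mod (- v).
Proof. by move=> [N N0 vN]; exists N => //; rewrite mulNrn; exact: (rpredNr vN). Qed.

Lemma torsion_modMn v n : torsion_mod v -> torsion_mod (v *+ n).
Proof. by move=> [N N0 vN]; exists N => //; rewrite -mulrnA mulnC mulrnA; exact: rpredMn. Qed.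

Lemma torsion_modMz v (z : int) : torsion_mod v -> torsion_mod (v *~ z).
Proof.
move=> tv; case: z => n; first exact: torsion_modMn.
exact/torsion_modN/torsion_modMn.
Qed.

Lemma torsion_mod_mem v : v \in H -> torsion_mod v.
Proof. by exists 1%N. Qed.

Lemma torsion_mod_divn v n : (0 < n)%N -> torsion_mod (v *+ n) -> torsion_mod v.
Proof.
by move=> n0 [N N0 vN]; exists (n * N)%N; rewrite ?mulrnA // muln_gt0 n0.
Qed.

Lemma torsion_mod_sum (I : eqType) (r : seq I) (p : pred I) (F : I -> V) :
  (forall i, i \in r -> p i -> torsion_mod (F i)) -> torsion_mod (\sum_(i <- r | p i) F i).
Proof.
move=> tF; rewrite big_seq_cond; apply: big_ind => [|u v|i /andP[ir pi]].
- exact: torsion_mod0.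
- exact: torsion_modD.
- exact: tF.
Qed.

End TorsionModulo.

Section ChowTorsion.
Variables (R : comNzRingType) (i : nat).
Local Notation H := (subgroup_gen (@rat_relators R i)).
Local Notation tor := (torsion_mod (H : zmodClosed (cycles R i))).

Lemma chow_torsion : (forall P : prime_of_dim R i, tor << P >>) -> is_torsion (chow R i).
Proof.
move=> torP v; rewrite -[v]reprK.
have [N N0 vN] : tor (repr v).
  rewrite -[repr v]freeg_sumE; apply: torsion_mod_sum => P _ _.
  by rewrite -[coeff _ _]intz -freegU_mulz; exact: torsion_modMz.
exists N => //; rewrite -[LHS](raddfMn (\pi_(@Quotient.quot _ H))).
apply: (elimT (@eqP (@Quotient.quot _ H) _ _)).
by rewrite -(raddf0 (\pi_(@Quotient.quot _ H))) -Quotient.idealrBE subr0.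
Qed.

(* The coefficients of div(x) at the primes of s other than P do not matter,
   so they need not be known to be finite. *)
Lemma torsion_of_divisor (Q : spec R) (P : prime_of_dim R i) (x : R)
    (s : seq (prime_of_dim R i)) N :
    (forall y, y \in spec_set Q -> y = 0) -> has_coheight Q i.+1 ->
    x != 0 -> x \in spec_set (sval P) ->
    (forall P' : prime_of_dim R i, x \in spec_set (sval P') -> P' \in s) ->
    (forall P', P' \in s -> P' != P -> tor << P' >>) ->
    (forall n (J : nat -> R -> Prop),
      (forall i, [/\ J i 0, forall a u v, J i u -> J i v -> J i (a * u + v),
                   forall y, J i (x * y) &
                   forall t a, t \notin spec_set (sval P) -> J i (t * a) -> J i a]) ->
      (forall i, (i < n)%N -> (forall a, J i a -> J i.+1 a) /\
        exists2 a, J i.+1 a & ~ J i a) -> (n <= N)%N) ->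
  tor << P >>.
Proof.
move=> Q0 hQ x0 xP sP tors bound.
pose M := mod_quot (@multiples _ (mod_quot (ideal_set Q)) x).
have lenP : (0 < loc_length (sval P) M)%N.
  apply: (loc_length_cyclic_gt0 (N := N) Q0 xP) => n /chain_of_ideals.
  by move=> /(_ Q0)[J [J1 J2]]; exact: bound J1 J2.
have divH : div_cycle i Q x \in H.
  apply/asboolP => G BG; apply: BG; exists Q, x; split => //.
  by apply/negP => /Q0 /eqP; rewrite (negPf x0).
(* Primes outside [s] do not contain [x] and have length 0, so the support is finite and the default
   value of the infinite sum is not met. *)
have divE : div_cycle i Q x = \sum_(P' <- undup s) << P' >> *+ loc_length (sval P') M.
  rewrite /div_cycle /cycle_of (fsbigE (undup s)) ?undup_uniq //=; last first.
    move=> P' _; rewrite mem_undup => P's.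
    rewrite loc_length_cyclic0 // ?freegU0 //.
    by apply: contra P's => /sP.
  rewrite big_mkcond; apply: eq_bigr => P' _.
  by rewrite in_setT freegU_muln natz.
have Ps : P \in undup s by rewrite mem_undup; apply: sP.
apply: (torsion_mod_divn lenP).
have -> : << P >> *+ loc_length (sval P) M = div_cycle i Q x -
    \sum_(P' <- undup s | P' != P) << P' >> *+ loc_length (sval P') M.
  by rewrite divE (bigD1_seq P) ?undup_uniq //= addrK.
apply: torsion_modD; first exact: torsion_mod_mem.
apply/torsion_modN/torsion_mod_sum => P'; rewrite mem_undup => P's P'P.
exact/torsion_modMn/tors.
Qed.

End ChowTorsion.

(** * Homogeneous components and binary forms *)

Section HomogeneousComponents.
Variables (A : comNzRingType) (G : nat -> {pred A}).
Hypothesis hG : is_grading G.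
Implicit Types (x y : A) (p q : {poly A}).

Let G0 d : 0 \in G d. Proof. by have [] := grading_zmod hG d. Qed.
Let GB d x y : x \in G d -> y \in G d -> x - y \in G d.
Proof. by have [_ h] := grading_zmod hG d; exact: h. Qed.
Let GN d x : x \in G d -> - x \in G d.
Proof. by rewrite -[- x]add0r; exact: GB. Qed.
Let GD d x y : x \in G d -> y \in G d -> x + y \in G d.
Proof. by move=> hx hy; rewrite -[y]opprK; apply: GB => //; exact: GN. Qed.

Lemma homogeneous_poly_inj p q : (forall d, p`_d \in G d) -> (forall d, q`_d \in G d) ->
  p.[1] = q.[1] -> p = q.
Proof.
move=> Gp Gq /eqP; rewrite -subr_eq0 => /eqP pq0.
have Gpq d : (p - q)`_d \in G d by rewrite coefB; exact: GB.
apply/eqP; rewrite -subr_eq0; apply/eqP/polyP => d; rewrite coef0.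
have [ltd|] := ltnP d (size (p - q)); last by move=> /(nth_default 0).
apply: (grading_direct hG Gpq _ ltd); rewrite -[RHS]pq0 -hornerN -hornerD horner_coef.
by apply: eq_bigr => e _; rewrite expr1n mulr1.
Qed.

Fact homogeneous_poly_exists x : exists p, (forall d, p`_d \in G d) /\ p.[1] = x.
Proof.
have [N [f [Gf ->]]] := grading_sum hG x; exists (\poly_(d < N) f d); split=> [d|].
  by rewrite coef_poly; case: ifP.
by rewrite horner_poly; apply: eq_bigr => d _; rewrite expr1n mulr1.
Qed.

(* The homogeneous components of x, as the polynomial \sum_d x_d 'X^d. *)
Definition components x : {poly A} := projT1 (cid (homogeneous_poly_exists x)).

Lemma component_in x d : (components x)`_d \in G d.
Proof. by rewrite /components; case: cid => p []. Qed.

Lemma components1 x : (components x).[1] = x.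
Proof. by rewrite /components; case: cid => p []. Qed.

Lemma componentsE x p : (forall d, p`_d \in G d) -> p.[1] = x -> components x = p.
Proof.
move=> Gp px; apply: homogeneous_poly_inj => //; first exact: component_in.
by rewrite components1.
Qed.

Lemma componentsD x y : components (x + y) = components x + components y.
Proof.
apply: componentsE => [d|]; last by rewrite hornerD !components1.
by rewrite coefD GD // component_in.
Qed.

Lemma componentsN x : components (- x) = - components x.
Proof.
apply: componentsE => [d|]; last by rewrite hornerN components1.
by rewrite coefN GN // component_in.
Qed.

Lemma components0 : components 0 = 0.
Proof. by apply: componentsE => [d|]; rewrite ?horner0 ?coef0. Qed.

Lemma components_sum (I : Type) (r : seq I) (F : I -> A) :
  components (\sum_(s <- r) F s) = \sum_(s <- r) components (F s).
Proof. exact: (big_morph _ componentsD components0). Qed.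

(** The Cauchy product of the two component sequences is again homogeneous degree by degree, so
    uniqueness of components applies. With [componentsD], the grading becomes a ring morphism from
    [A] to [{poly A}]. *)
Lemma componentsM x y : components (x * y) = components x * components y.
Proof.
apply: componentsE => [d|]; last by rewrite hornerM !components1.
rewrite coefM; apply: (big_ind (fun z => z \in G d)) => // [u v|e _]; first exact: GD.
have led : (e <= d)%N by rewrite -ltnS.
by rewrite -[d in G d](subnKC led); by apply: (grading_mul hG); exact: component_in.
Qed.

Lemma components_homogeneous d x : x \in G d -> components x = x%:P * 'X^d.
Proof.
move=> Gx; apply: componentsE => [e|]; last by rewrite !hornerE expr1n mulr1.
by rewrite coefCM coefXn; case: eqP => [->|_]; rewrite ?mulr1 ?mulr0.
Qed.

Lemma components_eq0 x : components x = 0 -> x = 0.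
Proof. by move=> c0; rewrite -[x]components1 c0 horner0. Qed.

Lemma sum_components x : x = \sum_(d < size (components x)) (components x)`_d.
Proof.
rewrite -[LHS]components1 horner_coef.
by apply: eq_bigr => d _; rewrite expr1n mulr1.
Qed.

Lemma spec_of_components (P : spec A) x :
  (forall d, (components x)`_d \in spec_set P) -> x \in spec_set P.
Proof. by move=> Px; rewrite [x]sum_components rpred_sum. Qed.

(* Used with I prime, for the largest homogeneous ideal in I, and with I = 0,
   for the absence of zero divisors. *)
Lemma homogeneous_core_prime (I : A -> Prop) :
    I 0 -> ~ I 1 -> (forall a x y, I x -> I y -> I (a * x + y)) ->
    (forall d e x y, x \in G d -> y \in G e -> I (x * y) -> I x \/ I y) ->
  exists P : spec A, forall x, x \in spec_set P <-> forall d, I (components x)`_d.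
Proof.
move=> I0 I1 Ilin IM.
have Isum (T : Type) (r : seq T) (p : pred T) (F : T -> A) :
    (forall s, p s -> I (F s)) -> I (\sum_(s <- r | p s) F s).
  move=> IF; apply: big_ind => // u v Iu Iv; rewrite -[u]mul1r; exact: Ilin.
have Imul a x : I x -> I (a * x) by move=> Ix; rewrite -[_ * _]addr0; exact: Ilin.
apply: spec_of_predicate => [d||a x y Ix Iy d|x y Ixy].
- by rewrite components0 coef0.
- have E1 : components 1 = 1%:P.
    by rewrite (@components_homogeneous 0) ?expr0 ?mulr1 //; exact: grading_one hG.
  by move=> /(_ 0%N); rewrite E1 coefC eqxx.
- rewrite componentsD componentsM coefD coefM -[X in I (X + _)]mul1r; apply: Ilin => //.
  by apply: Isum => e _; exact: Imul.
apply: contrapT => /not_orP[/existsNP nIx /existsNP nIy].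
have top z : (exists d, ~ I (components z)`_d) ->
    exists2 d, ~ I (components z)`_d & forall e, (d < e)%N -> I (components z)`_e.
  move=> [d0 nI0].
  have ex : exists d, `[< ~ I (components z)`_d >] by exists d0; apply/asboolP.
  have ub d : `[< ~ I (components z)`_d >] -> (d <= size (components z))%N.
    move=> /asboolP nI; rewrite leqNgt; apply/negP => ltd; apply: nI.
    by rewrite nth_default // ltnW.
  case: (ex_maxnP ex ub) => d /asboolP nId dmax; exists d => // e lt_de.
  apply: contrapT => nIe; have := dmax e; rewrite leqNgt lt_de.
  by case: asboolP => // _ /(_ isT).
have [d nId dmax] := top x nIx; have [e nIe emax] := top y nIy.
(* Every other term of the product in degree [d + e] has a component of [x] above [d] or of [y]
   above [e], hence lies in [I]. *)
have ltd : (d < (d + e).+1)%N by rewrite ltnS leq_addr.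
have := Ixy (d + e)%N; rewrite componentsM coefM (bigD1 (Ordinal ltd)) //= addKn.
set rest := \sum_(_ | _) _ => Isumxy.
have Irest : I rest.
  apply: Isum => s; rewrite -val_eqE /= => neq_sd.
  have [lt_ds|] := ltnP d s; first by rewrite mulrC; apply/Imul/dmax.
  by rewrite leq_eqVlt (negPf neq_sd) /= => lt_sd; apply/Imul/emax; lia.
have Ide : I ((components x)`_d * (components y)`_e).
  rewrite (_ : _ * _ = (-1) * rest + ((components x)`_d * (components y)`_e + rest)).
    exact: Ilin.
  by rewrite mulN1r addrC addrK.
by have [] := IM _ _ _ _ (component_in x d) (component_in y e) Ide.
Qed.

End HomogeneousComponents.

(** * Splitting of binary forms *)

Section BinaryForms.
Variable k : closedFieldType.

Definition bvar0 : 'I_2 := @Ordinal 2 0 isT.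
Definition bvar1 : 'I_2 := @Ordinal 2 1 isT.

Definition linear_form (l : k * k) : {mpoly k[2]} :=
  l.1%:MP * 'X_bvar0 + l.2%:MP * 'X_bvar1.

Definition homogenize d (p : {poly k}) : {mpoly k[2]} :=
  \sum_(s < d.+1) p`_s *: ('X_bvar0 ^+ s * 'X_bvar1 ^+ (d - s)).

Lemma homogenize_mulXsubC d (p : {poly k}) r : (size p <= d.+1)%N ->
  homogenize d.+1 (('X - r%:P) * p) = linear_form (1, - r) * homogenize d p.
Proof.
move=> szp; rewrite /linear_form mpolyC1 mul1r mpolyCN [RHS]mulrDl /=.
have -> : homogenize d.+1 (('X - r%:P) * p) =
    homogenize d.+1 ('X * p) + (- r) *: homogenize d.+1 p.
  rewrite /homogenize scaler_sumr -big_split; apply: eq_bigr => s _.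
  have -> : (('X - r%:P) * p)`_s = ('X * p)`_s + (- r) * p`_s.
    by rewrite mulrBl coefB coefCM mulNr.
  by rewrite /= scalerA -scalerDl.
congr (_ + _).
  rewrite /homogenize big_ord_recl coefXM eqxx scale0r add0r mulr_sumr.
  apply: eq_bigr => s _; rewrite coefXM /= subSS -scalerAr mulrA -exprS.
  by rewrite /bump leq0n add1n.
rewrite -mulrA -mpolyCN mul_mpolyC; congr (_ *: _).
rewrite /homogenize big_ord_recr /= (nth_default 0 szp) scale0r addr0 mulr_sumr.
apply: eq_bigr => s _; rewrite -scalerAr subSn -1?ltnS // exprS; congr (_ *: _); ring.
Qed.

(** The padding by [(0, 1)], which is the form ['X_bvar1], stands for the roots at infinity, present
    when the polynomial has degree below [d]. *)
Lemma homogenize_prod (rs : seq k) d : (size rs <= d)%N ->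
  homogenize d (\prod_(r <- rs) ('X - r%:P)) =
    \prod_(l <- map (fun r => (1, - r)) rs ++ nseq (d - size rs) (0, 1)) linear_form l.
Proof.
elim: rs d => [|r rs IH] d /=.
  move=> _; rewrite big_nil subn0 big_nseq iter_mulr_1 /homogenize big_ord_recl.
  rewrite coef1 eqxx expr0 mul1r subn0 scale1r big1 => [|s _].
    by rewrite addr0 /linear_form mpolyC0 mul0r add0r mpolyC1 mul1r.
  by rewrite coef1 scale0r.
case: d => // d lers; rewrite !big_cons homogenize_mulXsubC ?IH //.
by rewrite size_prod_XsubC.
Qed.

(** Setting the second variable to 1 gives a polynomial in one variable, which splits over [k];
    homogenizing the factors recovers [t]. The count [size ls = d] separates constants from forms
    that have a linear factor. *)
Lemma binary_form_factor d (t : {mpoly k[2]}) : t \is d.-homog -> t != 0 ->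
  exists c (ls : seq (k * k)), [/\ c != 0, size ls = d,
    forall l, l \in ls -> l != (0, 0) & t = c%:MP * \prod_(l <- ls) linear_form l].
Proof.
move=> ht t0.
pose mon s : 'X_{1..2} := (U_(bvar0) *+ s + U_(bvar1) *+ (d - s))%MM.
pose p := \poly_(s < d.+1) t@_(mon s).
have tE : t = homogenize d p.
  apply/mpolyP => m; rewrite raddf_sum /=.
  have monE s : 'X_bvar0 ^+ s * 'X_bvar1 ^+ (d - s) = 'X_[mon s] :> {mpoly k[2]}.
    by rewrite !mpolyXn -mpolyXD.
  have mdegm : mdeg m = (m bvar0 + m bvar1)%N.
    by rewrite mdegE !big_ord_recl big_ord0 addn0; congr (m _ + m _)%N; apply: val_inj.
  have [dm|ndm] := eqVneq (mdeg m) d; last first.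
    rewrite (dhomog_nemf_coeff ht ndm) big1 // => s _.
    rewrite monE mcoeffZ mcoeffX; case: eqP => [mE|_]; last by rewrite mulr0.
    by move: ndm; rewrite -mE mdegD !mdegMn !mdeg1 !mul1n subnKC ?eqxx // -ltnS.
  have ltm : (m bvar0 < d.+1)%N by rewrite -dm mdegm ltnS leq_addr.
  have mon_m : mon (m bvar0) = m.
    apply/mnmP => s; rewrite mnmDE !mulmnE !mnm1E -dm mdegm addKn.
    case: s => -[|[|//]] lts /=.
      by rewrite mul1n mul0n addn0; congr (m _); apply: val_inj.
    by rewrite mul1n mul0n add0n; congr (m _); apply: val_inj.
  rewrite (bigD1 (Ordinal ltm)) //= big1 => [|s neq_s].
    by rewrite addr0 monE mon_m mcoeffZ mcoeffX eqxx mulr1 coef_poly ltm mon_m.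
  rewrite monE mcoeffZ mcoeffX; case: eqP => [mE|_]; last by rewrite mulr0.
  case/eqP: neq_s; apply: val_inj; rewrite /= -mE mnmDE !mulmnE !mnm1E /=.
  by rewrite mul1n mul0n addn0.
have p0 : p != 0.
  apply: contraNneq t0 => p0; rewrite tE p0 /homogenize big1 // => s _.
  by rewrite coef0 scale0r.
have [rs pE] := closed_field_poly_normal p.
have szrs : (size rs <= d)%N.
  have : (size p <= d.+1)%N by exact: size_poly.
  by rewrite pE size_scale ?lead_coef_eq0 // size_prod_XsubC.
exists (lead_coef p), (map (fun r => (1, - r)) rs ++ nseq (d - size rs) (0, 1)); split.
- by rewrite lead_coef_eq0.
- by rewrite size_cat size_map size_nseq subnKC.
- move=> l; rewrite mem_cat => /orP[/mapP[r _ ->]|/nseqP[-> _]].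
    by rewrite xpair_eqE oner_eq0.
  by rewrite xpair_eqE oner_eq0 andbF.
rewrite {1}tE {1}pE -homogenize_prod // mul_mpolyC /homogenize scaler_sumr.
by apply: eq_bigr => s _; rewrite coefZ scalerA.
Qed.

Lemma linear_form_homog l : linear_form l \is 1.-homog.
Proof.
by apply: rpredD; rewrite mul_mpolyC; apply: dhomogZ; rewrite dhomogX /= mdeg1.
Qed.

Lemma linear_form_neq0 l : l != (0, 0) -> linear_form l != 0.
Proof.
case: l => a b; apply: contraNneq => /mpolyP l0.
have := l0 U_(bvar0)%MM; have := l0 U_(bvar1)%MM.
rewrite !mcoeffD !mcoeffCM !mcoeffX !mcoeff0 !eqxx /=.
have -> : (U_(bvar0) == U_(bvar1) :> 'X_{1..2})%MM = false.
  by apply/eqP => /mnmP/(_ bvar0); rewrite !mnm1E.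
have -> : (U_(bvar1) == U_(bvar0) :> 'X_{1..2})%MM = false.
  by apply/eqP => /mnmP/(_ bvar0); rewrite !mnm1E.
by rewrite !mulr0 !mulr1 addr0 add0r => -> ->.
Qed.

Lemma linear_form_proportional (l l' : k * k) : l != (0, 0) ->
    l.1 * l'.2 - l.2 * l'.1 = 0 ->
  exists c, linear_form l' = linear_form l * c%:MP.
Proof.
case: l l' => a b [a' b'] /= l0 det0.
suff [c ca cb] : exists2 c, a' = a * c & b' = b * c.
  by exists c; rewrite /linear_form /= ca cb !mpolyCM; ring.
have [a0|a0] := eqVneq a 0.
  have b0 : b != 0 by apply: contraNneq l0 => ->; rewrite a0.
  exists (b' / b); last by rewrite mulrC divfK.
  move: det0; rewrite a0 !mul0r sub0r => /eqP.
  by rewrite oppr_eq0 mulf_eq0 (negPf b0) => /eqP.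
exists (a' / a); first by rewrite mulrC divfK.
apply: (mulfI a0); move/eqP: det0; rewrite subr_eq0 => /eqP ->.
by rewrite mulrCA [a * _]mulrC divfK.
Qed.

End BinaryForms.

(** * Graded rings over the plane *)

Section GradedOverPlane.
Variables (k : closedFieldType) (n N : nat) (R : comNzRingType).
Variables (G : nat -> {pred R}) (hG : is_grading G).
Variable i : {rmorphism {mpoly k[2]} -> R}.
Hypotheses (n_gt0 : (0 < n)%N) (i_inj : injective i).
Hypothesis i_homog : forall d t, t \is d.-homog -> i t \in G (n * d)%N.
(** The degrees match: both variables have weight [n] in [R], so a form of degree [d] has the weight
    [n * d] of [a ^+ n]. *)
Hypothesis power_in_plane : forall d a, a \in G d -> a != 0 ->
  exists t, [/\ t \is d.-homog, t != 0 & a ^+ n = i t].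
Hypothesis bounded_rank : forall a : 'I_N -> R, exists v : 'I_N -> {mpoly k[2]},
  (exists s, v s != 0) /\ \sum_s i (v s) * a s = 0.
Hypothesis dim_le2 : forall (P : spec R) m, chain_above P m -> (m <= 2)%N.
Hypothesis dim_ge2 : exists P : spec R, chain_above P 2.

Local Notation comp := (components hG).
Implicit Types (P : spec R) (x y a : R).

(** It suffices to multiply homogeneous elements; if two nonzero ones had product 0, their n-th
    powers would be nonzero forms with product 0 in [k[X_1, X_2]]. *)
Lemma zero_prime : exists Z : spec R, forall y, y \in spec_set Z <-> y = 0.
Proof.
have [|||d e a b Ga Gb ab0|Z hZ] := @homogeneous_core_prime _ _ hG (fun y => y = 0).
- by [].
- by apply/eqP; rewrite oner_eq0.
- by move=> a x y -> ->; rewrite mulr0 addr0.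
- have [a0|a_neq0] := eqVneq a 0; first by left.
  have [b0|b_neq0] := eqVneq b 0; first by right.
  have [t [_ t0 at_]] := power_in_plane Ga a_neq0.
  have [s [_ s0 bs]] := power_in_plane Gb b_neq0.
  have /eqP : i (t * s) = i 0.
    by rewrite rmorphM -at_ -bs -exprMn ab0 expr0n eqn0Ngt n_gt0 rmorph0.
  by rewrite (inj_eq i_inj) mulf_eq0 (negPf t0) (negPf s0).
exists Z => y; split=> [/hZ c0|->]; last exact: rpred0.
by apply: (@components_eq0 _ _ hG); apply/polyP => d; rewrite c0 coef0.
Qed.

Lemma domain_mul_eq0 x y : x * y = 0 -> x = 0 \/ y = 0.
Proof.
have [Z hZ] := zero_prime; move=> /hZ.
by rewrite specM => /orP[] /hZ; [left|right].
Qed.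

Lemma i_neq0 t : t != 0 -> i t != 0.
Proof. by rewrite -(inj_eq i_inj) rmorph0. Qed.

Lemma coheight2_zero (Z : spec R) : (forall y, y \in spec_set Z <-> y = 0) ->
  has_coheight Z 2.
Proof.
move=> hZ; apply/has_coheightP; split=> [|m]; last exact: dim_le2.
have [P ch] := dim_ge2; apply: chain_above_trans ch => y /hZ ->; exact: rpred0.
Qed.

(** * Homogeneous primes of coheight 1 *)

Definition graded_prime P := forall x d, x \in spec_set P -> (comp x)`_d \in spec_set P.

Definition meets_homogeneous P := exists d a, [/\ a \in G d, a != 0 & a \in spec_set P].

(** The homogeneous elements of [P] generate a prime [S], nonzero because of [a]. If it were smaller
    than [P], then 0, [S], [P] and a prime above [P] would form a chain of length 3. *)
Lemma homogeneous_coheight1 P : has_coheight P 1 -> meets_homogeneous P -> graded_prime P.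
Proof.
move=> hP [d [a [Ga a0 aP]]].
have [|||? ? x y _ _|S hS] := @homogeneous_core_prime _ _ hG (fun y => y \in spec_set P).
- exact: rpred0.
- exact: spec1.
- by move=> b x y hx hy; rewrite rpredD // idealMr.
- by rewrite specM => /orP.
have SP : {subset spec_set S <= spec_set P}.
  by move=> x /hS; exact: spec_of_components.
have [PS x e xP|nPS] := pselect {subset spec_set P <= spec_set S}.
  by have /hS := PS _ xP; apply.
have [Z hZ] := zero_prime.
have ZS : proper_subset (spec_set Z) (spec_set S).
  split=> [y /hZ ->|SZ]; first exact: rpred0.
  have aS : a \in spec_set S.
    apply/hS => e; rewrite (components_homogeneous hG Ga) coefCM coefXn.
    by case: (_ == _); rewrite ?mulr1 ?mulr0 ?rpred0.
  by move: a0; rewrite (iffLR (hZ a) (SZ _ aS)) eqxx.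
have [chP _] := iffLR (has_coheightP _ _) hP.
by have := dim_le2 (chain_above_cons ZS (chain_above_cons (conj SP nPS) chP)).
Qed.

(* The only prime containing both coordinates is the irrelevant ideal, which is
   maximal: modulo it every element is its degree 0 component, a scalar up to
   an n-th power. *)
Lemma coordinates_notin P : has_coheight P 1 ->
  i 'X_bvar0 \in spec_set P -> i 'X_bvar1 \in spec_set P -> False.
Proof.
move=> hP X0P X1P; have [Q [PQ nQP]] := coheight1_proper_above hP.
apply: nQP => b bQ.
have compP d : (comp b)`_d.+1 \in spec_set P.
  have [->|bd0] := eqVneq (comp b)`_d.+1 0; first exact: rpred0.
  have [t [ht t0 tE]] := power_in_plane (component_in hG b d.+1) bd0.
  rewrite -(specX _ _ n_gt0) tE.
  have [c [[|l ls] [// _ _ _ ->]]] := binary_form_factor ht t0.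
  rewrite big_cons /linear_form mulrCA mulrDl rmorphD !rmorphM rpredD //.
    by rewrite specMr // idealMr.
  by rewrite specMr // idealMr.
apply: (@spec_of_components _ _ hG) => -[|//].
have [->|b0] := eqVneq (comp b)`_0 0; first exact: rpred0.
have [t [ht t0 tE]] := power_in_plane (component_in hG b 0) b0.
have b0Q : (comp b)`_0 \in spec_set Q.
  have [/size0nil ->|szb] := eqVneq (size (comp b)) 0%N; first by rewrite nth_nil rpred0.
  have := sum_components hG b; case: (size _) szb => // m _; rewrite big_ord_recl.
  set rest := \sum_(_ < _) _ => bE.
  rewrite -(addrK rest (comp b)`_0) rpredB //; first by rewrite -[X in X \in _]bE.
  by apply: rpred_sum => s _; exact/PQ/(compP s).
(* The n-th power of the degree 0 component is a form of degree 0, hence a nonzero scalar, and a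
   unit cannot lie in [Q]. *)
exfalso; have [c [ls [c0 /size0nil lsE _ cE]]] := binary_form_factor ht t0.
move: b0Q; rewrite -(specX _ _ n_gt0) tE cE lsE big_nil mulr1.
move=> /(idealMr (i (c^-1)%:MP)); rewrite -rmorphM -mpolyCM mulVf // mpolyC1 rmorph1.
exact: spec1.
Qed.

(** By Cramer's rule, two forms with nonzero determinant would put both coordinates in [P], against
    [coordinates_notin]. *)
Lemma linear_forms_in_prime P l l' : has_coheight P 1 -> l != (0, 0) ->
    i (linear_form l) \in spec_set P -> i (linear_form l') \in spec_set P ->
  exists c, linear_form l' = linear_form l * c%:MP.
Proof.
move=> hP l0 lP l'P.
have [/(linear_form_proportional l0) //|det0] := eqVneq (l.1 * l'.2 - l.2 * l'.1) 0.
have inP t : i ((l.1 * l'.2 - l.2 * l'.1)%:MP * t) \in spec_set P -> i t \in spec_set P.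
  rewrite rmorphM specM => /orP[|//] /(idealMr (i ((l.1 * l'.2 - l.2 * l'.1)^-1)%:MP)).
  by rewrite -rmorphM -mpolyCM mulVf // mpolyC1 rmorph1 => /spec1.
exfalso; apply: (coordinates_notin hP); apply: inP.
  rewrite (_ : _ * _ = l'.2%:MP * linear_form l - l.2%:MP * linear_form l').
    by rewrite rmorphB !rmorphM rpredB // idealMr.
  by rewrite /linear_form mpolyCB !mpolyCM; ring.
rewrite (_ : _ * _ = l.1%:MP * linear_form l' - l'.1%:MP * linear_form l).
  by rewrite rmorphB !rmorphM rpredB // idealMr.
by rewrite /linear_form mpolyCB !mpolyCM; ring.
Qed.

Lemma linear_factor_in_prime P d t : t \is d.-homog -> t != 0 ->
    i t \in spec_set P ->
  exists l q, [/\ l != (0, 0), i (linear_form l) \in spec_set P & t = linear_form l * q].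
Proof.
move=> ht t0; have [c [ls [c0 _ ls0 ->]]] := binary_form_factor ht t0.
rewrite rmorphM specM => /orP[/(idealMr (i (c^-1)%:MP))|].
  by rewrite -rmorphM -mpolyCM mulVf // mpolyC1 rmorph1 => /spec1.
rewrite rmorph_prod => /spec_prod/hasP[l lls lP].
exists l, (c%:MP * \prod_(l' <- rem l ls) linear_form l'); split=> //; first exact: ls0.
by rewrite (big_rem l) //= mulrCA.
Qed.

Lemma linear_form_meets l P : l != (0, 0) -> i (linear_form l) \in spec_set P ->
  meets_homogeneous P.
Proof.
move=> l0 lP; exists (n * 1)%N, (i (linear_form l)); split=> //.
  exact/i_homog/linear_form_homog.
exact/i_neq0/linear_form_neq0.
Qed.

(** The n-th power of a homogeneous element of [P] has a linear factor in [P], which is proportional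
    to [l]; the element therefore lies in every prime containing [l]. *)
Lemma coheight1_linear_form_uniq P P' l : has_coheight P 1 -> has_coheight P' 1 ->
    l != (0, 0) -> i (linear_form l) \in spec_set P -> i (linear_form l) \in spec_set P' ->
  P = P'.
Proof.
move=> hP hP' l0 lP lP'; apply: coheight1_eq => // x xP.
have gP := homogeneous_coheight1 hP (linear_form_meets l0 lP).
apply: (@spec_of_components _ _ hG) => d.
have [->|xd0] := eqVneq (comp x)`_d 0; first exact: rpred0.
have [t [ht t0 tE]] := power_in_plane (component_in hG x d) xd0.
have /(linear_factor_in_prime ht t0)[l' [q [_ l'P tq]]] : i t \in spec_set P.
  by rewrite -tE specX // gP.
have [c l'E] := linear_forms_in_prime hP l0 lP l'P.
by rewrite -(specX _ _ n_gt0) tE tq l'E !rmorphM specMr // specMr.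
Qed.

(** The contraction of [P] to [k[X_1, X_2]] is principal, generated by [l]: [P] is homogeneous, so
    the claim reduces to forms, and each form in [P] has a linear factor proportional to [l]. *)
Lemma plane_trace P l t : has_coheight P 1 -> l != (0, 0) ->
    i (linear_form l) \in spec_set P -> i t \in spec_set P ->
  exists q, t = linear_form l * q.
Proof.
move=> hP l0 lP tP.
have gP := homogeneous_coheight1 hP (linear_form_meets l0 lP).
have tE := pihomog_partitionE (leqnn (msize t)).
have dvd d : exists q, pihomog mdeg d t = linear_form l * q.
  have [td0|td0] := eqVneq (pihomog mdeg d t) 0; first by exists 0; rewrite td0 mulr0.
  have [ltd|led] := ltnP d (msize t); last first.
    exists 0; rewrite mulr0 pihomogE big_seq_cond big1 // => m /andP[mt /eqP md].
    by have := msize_mdeg_lt mt; rewrite md ltnNge led.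
  have /(linear_factor_in_prime (pihomogP _ _ _) td0)[l' [q [_ l'P tq]]] :
      i (pihomog mdeg d t) \in spec_set P.
    (* Forms of distinct degrees have distinct weights because [n > 0], so the component of weight
       [n * d] is the image of the degree [d] part of [t]. *)
    have := gP _ (n * d)%N tP; rewrite {1}tE rmorph_sum components_sum coef_sum.
    rewrite (bigD1 (Ordinal ltd)) //= big1 => [|s neq_s].
      rewrite (components_homogeneous hG (i_homog (pihomogP _ _ _))).
      by rewrite coefCM coefXn eqxx mulr1 addr0.
    rewrite (components_homogeneous hG (i_homog (pihomogP _ _ _))).
    rewrite coefCM coefXn eqn_pmul2l // eq_sym.
    by rewrite -val_eqE /= in neq_s; rewrite (negPf neq_s) mulr0.
  have [c l'E] := linear_forms_in_prime hP l0 lP l'P.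
  by exists (c%:MP * q); rewrite tq l'E mulrA.
have /choice[q qE] := dvd.
exists (\sum_(d < msize t) q d); rewrite mulr_sumr {1}tE.
by apply: eq_bigr => d _; rewrite qE.
Qed.

(** If all coefficients lie in [P], they are divisible by [l], and since [R] has no zero divisors
    the relation can be divided by [l]. The size of one fixed nonzero coefficient drops by one each
    time. *)
Lemma primitive_relation P l (a : 'I_N -> R) : has_coheight P 1 -> l != (0, 0) ->
    i (linear_form l) \in spec_set P ->
  exists v : 'I_N -> {mpoly k[2]},
    (exists s, i (v s) \notin spec_set P) /\ \sum_s i (v s) * a s = 0.
Proof.
move=> hP l0 lP; have [v [[s0 vs0] rel]] := bounded_rank a.
move: {2}(msize _) (leqnn (msize (v s0))) => m.
elim: m v vs0 rel => [|m IH] v vs0 rel lem.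
  by move: vs0; rewrite -msize_poly_eq0 -leqn0 lem.
have [[s vsP]|allP] := pselect (exists s, i (v s) \notin spec_set P).
  by exists v; split=> //; exists s.
have vP s : i (v s) \in spec_set P.
  by apply/negPn/negP => vsP; apply: allP; exists s.
have /choice[q qE] : forall s, exists q, v s = linear_form l * q.
  by move=> s; exact: plane_trace hP l0 lP (vP s).
have qs0 : q s0 != 0 by apply: contraNneq vs0 => q0; rewrite qE q0 mulr0.
apply: (IH q) => //.
- have : i (linear_form l) * \sum_s i (q s) * a s = 0.
    rewrite mulr_sumr -[RHS]rel; apply: eq_bigr => s _.
    by rewrite qE rmorphM mulrA.
  by move=> /domain_mul_eq0[/eqP|//]; rewrite (negPf (i_neq0 (linear_form_neq0 l0))).
move: lem; rewrite qE msizeM ?linear_form_neq0 //.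
suff -> : msize (linear_form l) = 2%N by [].
have := mlead_deg (linear_form_neq0 l0).
by rewrite (dhomog_mf (linear_form_homog l)) // mlead_supp // linear_form_neq0.
Qed.

(** Choose [a s] in [J s.+1] outside [J s] and a primitive relation among these. At the last index
    [s] with a coefficient outside [P], earlier terms lie in [J s] by monotonicity, and later ones
    because their coefficients are multiples of [l]. Saturation then puts [a s] in [J s], a
    contradiction. *)
Lemma graded_length_bound P l m (J : nat -> R -> Prop) :
    has_coheight P 1 -> l != (0, 0) -> i (linear_form l) \in spec_set P ->
    (forall s, [/\ J s 0, forall a u v, J s u -> J s v -> J s (a * u + v),
                 forall y, J s (i (linear_form l) * y) &
                 forall t a, t \notin spec_set P -> J s (t * a) -> J s a]) ->
    (forall s, (s < m)%N -> (forall a, J s a -> J s.+1 a) /\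
      exists2 a, J s.+1 a & ~ J s a) -> (m <= N)%N.
Proof.
move=> hP l0 lP J1 J2; rewrite leqNgt; apply/negP => ltNm.
have /choice[a aE] : forall s : 'I_N, exists a, J s.+1 a /\ ~ J s a.
  by move=> s; have [_ [a]] := J2 s (ltn_trans (ltn_ord s) ltNm); exists a.
have [v [[s0 vs0] rel]] := primitive_relation a hP l0 lP.
have [s vsP smax] := @arg_maxnP _ s0 (fun s => i (v s) \notin spec_set P) (fun s => s) vs0.
have [_ nas] := aE s; apply: nas; have [Js0 Jlin Jmul Jsat] := J1 s.
apply: (Jsat _ _ vsP).
have Jmono p q b : (p <= q)%N -> (q <= m)%N -> J p b -> J q b.
  elim: q => [|q IH]; first by rewrite leqn0 => /eqP->.
  rewrite leq_eqVlt => /predU1P[->//|lepq] ltqm Jp.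
  by have [sub _] := J2 _ ltqm; apply/sub/IH => //; exact: ltnW.
move: rel; rewrite (bigD1 s) //= => /eqP; rewrite addr_eq0 => /eqP ->.
rewrite -mulN1r -[_ * _]addr0; apply: (Jlin) => //.
apply: (big_ind (J s)) => // [x y Jx Jy|s' neq_s]; first by rewrite -[x]mul1r; exact: (Jlin).
have [lt_s|] := ltnP s' s.
  rewrite -[_ * _]addr0; apply: (Jlin) => //.
  have [Ja _] := aE s'; apply: Jmono Ja => //.
  exact: ltnW (ltn_trans (ltn_ord s) ltNm).
rewrite leq_eqVlt eq_sym val_eqE (negPf neq_s) /= => lt_s.
have [q ->] : exists q, v s' = linear_form l * q.
  apply: (plane_trace hP l0 lP); apply: contraLR lt_s => /smax.
  by rewrite -leqNgt.
by rewrite rmorphM -mulrA.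
Qed.

(** A homogeneous prime containing [x] contains a chosen nonzero component of [x], hence one of the
    finitely many linear factors of its n-th power, and each factor determines at most one prime.
    The list may also hold primes that do not contain [x]; these have coefficient 0 in the divisor
    of [x]. *)
Lemma finitely_many_homogeneous x : x != 0 ->
  exists s : seq (prime_of_dim R 1),
    (forall P : prime_of_dim R 1, P \in s -> meets_homogeneous (sval P)) /\
    (forall P : prime_of_dim R 1, x \in spec_set (sval P) ->
       meets_homogeneous (sval P) -> P \in s).
Proof.
move=> x0.
have [d xd0] : exists d, (comp x)`_d != 0.
  apply: contrapT => nex; case/eqP: x0; apply: (@components_eq0 _ _ hG).
  apply/polyP => d; rewrite coef0; apply: contrapT => /eqP xd0.
  by apply: nex; exists d.
have [t [ht t0 tE]] := power_in_plane (component_in hG x d) xd0.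
have [c [ls [c0 _ ls0 tls]]] := binary_form_factor ht t0.
have [s [s1 s2]] : exists s : seq (prime_of_dim R 1),
    (forall P : prime_of_dim R 1, P \in s -> meets_homogeneous (sval P)) /\
    (forall P : prime_of_dim R 1, has (fun l => i (linear_form l) \in spec_set (sval P)) ls ->
      P \in s).
  elim: ls ls0 {tls} => [|l ls IH] ls0; first by exists [::].
  have l0 : l != (0, 0) by apply: ls0; rewrite mem_head.
  have [|s [s1 s2]] := IH; first by move=> l' l'ls; apply: ls0; rewrite in_cons l'ls orbT.
  have [[P lP]|nex] := pselect (exists P : prime_of_dim R 1,
      i (linear_form l) \in spec_set (sval P)).
    exists (P :: s); split=> P'; rewrite in_cons.
      by move=> /orP[/eqP->|/s1 //]; exact: linear_form_meets l0 lP.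
    move=> /= /orP[lP'|/s2 ->]; last by rewrite orbT.
    apply/orP; left; apply/eqP/val_inj.
    apply: coheight1_linear_form_uniq l0 lP' lP.
      by have /asboolP := svalP P'.
    by have /asboolP := svalP P.
  exists s; split=> // P' /= /orP[lP'|/s2 //].
  by case: nex; exists P'.
exists s; split=> // P xP mP; apply: s2.
have hP : has_coheight (sval P) 1 by have /asboolP := svalP P.
have := homogeneous_coheight1 hP mP d xP; rewrite -(specX _ _ n_gt0) tE tls.
rewrite rmorphM specM => /orP[/(idealMr (i (c^-1)%:MP))|].
  by rewrite -rmorphM -mpolyCM mulVf // mpolyC1 rmorph1 => /spec1.
by rewrite rmorph_prod => /spec_prod.
Qed.

(* A nonzero element of P whose homogeneous components occupy the shortest
   possible range of degrees generates P up to homogeneous denominators: this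
   is Euclidean division in the localization of R at its homogeneous elements. *)
Lemma homogeneous_localization_principal P : ~ meets_homogeneous P ->
    (exists2 y, y \in spec_set P & y != 0) ->
  exists x, [/\ x != 0, x \in spec_set P & forall a, a \in spec_set P ->
    exists u y, [/\ u \notin spec_set P,
      ~ (exists2 P', ~ meets_homogeneous P' & u \in spec_set P') & u * a = x * y]].
Proof.
move=> nmP [y0 y0P y0_neq0].
pose W x e w := forall d, (comp x)`_d != 0 -> (e <= d < e + w)%N.
pose Q w := exists x e, [/\ x \in spec_set P, x != 0 & W x e w].
have exQ : exists w, `[< Q w >].
  exists (size (comp y0)); apply/asboolP; exists y0, 0%N; split=> // d.
  by rewrite add0n ltnNge; apply: contra => /(nth_default 0) ->.
case: (ex_minnP exQ) => w /asboolP[x [e [xP x0 Wx]]] wmin; exists x; split=> //.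
case: w wmin Wx => [|w] wmin Wx.
  case/eqP: x0; apply: (@components_eq0 _ _ hG); apply/polyP => d; rewrite coef0.
  by apply/eqP/negPn/negP => /Wx; rewrite addn0 ltnNge andbN.
pose xt := (comp x)`_(e + w).
(* If the top component vanished, the width could be lowered by one. *)
have xt0 : xt != 0.
  apply/eqP => xt0; have := wmin w; rewrite ltnn => h; suff /h : `[< Q w >] by [].
  apply/asboolP; exists x, e; split=> // d xd0; have := Wx _ xd0.
  rewrite addnS ltnS => /andP[-> /=]; rewrite leq_eqVlt => /predU1P[dE|//].
  by move: xd0; rewrite dE -/xt xt0 eqxx.
have Gxt : xt \in G (e + w) by exact: component_in.
suff key v : forall a e', a \in spec_set P -> W a e' v ->
    exists u d y, [/\ u \in G d, u != 0 & u * a = x * y].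
  move=> a aP; have [|u [d [y [Gu u0 uE]]]] := key (size (comp a)) a 0%N aP.
    by move=> d; rewrite add0n ltnNge; apply: contra => /(nth_default 0) ->.
  exists u, y; split=> //.
    by apply/negP => uP; apply: nmP; exists d, u.
  by move=> [P' nmP' uP']; apply: nmP'; exists d, u.
have zero_case a : a = 0 -> exists u d y, [/\ u \in G d, u != 0 & u * a = x * y].
  move=> ->; exists 1, 0%N, 0; split; rewrite ?mulr0 ?oner_eq0 //.
  exact: grading_one hG.
elim: v => [|v IH] a e' aP Wa.
  apply: zero_case; apply: (@components_eq0 _ _ hG); apply/polyP => d; rewrite coef0.
  by apply/eqP/negPn/negP => /Wa; rewrite addn0 ltnNge andbN.
have [a0|a0] := eqVneq a 0; first exact: zero_case.
have lewv : (w <= v)%N by rewrite -ltnS wmin //; apply/asboolP; exists a, e'.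
pose at_ := (comp a)`_(e' + v).
have Gat : at_ \in G (e' + v) by exact: component_in.
(* Both products end at the latest in degree [e + w + e' + v], where they cancel. As [w <= v],
   neither has a component below [e + w + e'], so [b] fits in a range of width [v]. *)
pose b := xt * a - at_ * x.
have bE d : (comp b)`_d =
    (if (d < e + w)%N then 0 else xt * (comp a)`_(d - (e + w))) -
    (if (d < e' + v)%N then 0 else at_ * (comp x)`_(d - (e' + v))).
  rewrite /b componentsD componentsN !componentsM (components_homogeneous hG Gxt).
  rewrite (components_homogeneous hG Gat) coefB -!mulrA !coefCM !coefXnM.
  by congr (_ - _); case: ifP; rewrite ?mulr0.
have bP : b \in spec_set P by rewrite rpredB // idealMr.
have [|u [d [y [Gu u0 uE]]]] := IH b (e + w + e')%N bP.
  move=> d; rewrite bE.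
  have [dE|neq_d] := eqVneq d (e + w + (e' + v))%N.
    have -> : (d < e + w)%N = false by lia.
    have -> : (d < e' + v)%N = false by lia.
    have -> : (d - (e + w) = e' + v)%N by lia.
    have -> : (d - (e' + v) = e + w)%N by lia.
    by rewrite -/xt -/at_ mulrC subrr eqxx.
  case: (ltnP d (e + w)) => h1; case: (ltnP d (e' + v)) => h2.
  - by rewrite subrr eqxx.
  - rewrite sub0r oppr_eq0 => nz.
    have /Wx : (comp x)`_(d - (e' + v)) != 0.
      by apply: contraNneq nz => ->; rewrite mulr0.
    lia.
  - rewrite subr0 => nz.
    have /Wa : (comp a)`_(d - (e + w)) != 0.
      by apply: contraNneq nz => ->; rewrite mulr0.
    lia.
  - move=> nz.
    have [xd|/Wx] := eqVneq (comp x)`_(d - (e' + v)) 0; last lia.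
    have /Wa : (comp a)`_(d - (e + w)) != 0.
      by apply: contraNneq nz => ad; rewrite ad xd !mulr0 subrr.
    lia.
exists (u * xt), (d + (e + w))%N, (y + u * at_); split.
- exact: (grading_mul hG).
- by apply/eqP => /domain_mul_eq0[]; apply/eqP.
by rewrite mulrDr -uE /b; ring.
Qed.

Theorem chow1_torsion : is_torsion (chow R 1).
Proof.
have [Z hZ] := zero_prime; have hZ2 := coheight2_zero hZ.
have Z0 y : y \in spec_set Z -> y = 0 by move/hZ.
pose H := subgroup_gen (@rat_relators R 1).
have graded_case (P : prime_of_dim R 1) : meets_homogeneous (sval P) ->
    torsion_mod (H : zmodClosed (cycles R 1)) << P >>.
  move=> [d [a [Ga a0 aP]]].
  have hP : has_coheight (sval P) 1 by have /asboolP := svalP P.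
  have [t [ht t0 tE]] := power_in_plane Ga a0.
  have /(linear_factor_in_prime ht t0)[l [q [l0 lP _]]] : i t \in spec_set (sval P).
    by rewrite -tE specX.
  apply: (@torsion_of_divisor _ _ Z P (i (linear_form l)) [:: P] N) => //.
  - exact/i_neq0/linear_form_neq0.
  - move=> P' lP'; rewrite mem_seq1; apply/eqP/val_inj.
    apply: coheight1_linear_form_uniq l0 lP' lP => //.
    by have /asboolP := svalP P'.
  - by move=> P'; rewrite mem_seq1 => ->.
  - by move=> m J; exact: graded_length_bound hP l0 lP.
apply: chow_torsion => P.
have hP : has_coheight (sval P) 1 by have /asboolP := svalP P.
have [/graded_case //|nmP] := pselect (meets_homogeneous (sval P)).
have [|x [x0 xP gen]] := homogeneous_localization_principal nmP.
  (* [P] is nonzero: otherwise it would inherit the chain of length 2 above [Z]. *)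
  apply: contrapT => nex; have [_ /(_ 2%N)] := iffLR (has_coheightP _ _) hP.
  have [chZ _] := iffLR (has_coheightP _ _) hZ2.
  suff PZ : {subset spec_set (sval P) <= spec_set Z}.
    by move=> /(_ (chain_above_trans PZ chZ)).
  move=> y yP; apply/hZ; apply: contrapT => /eqP y0; apply: nex.
  by exists y.
have [s [s1 s2]] := finitely_many_homogeneous x0.
apply: (@torsion_of_divisor _ _ Z P x (P :: s) 1) => //.
- move=> P' xP'; rewrite in_cons.
  have [mP'|nmP'] := pselect (meets_homogeneous (sval P')); first by rewrite s2 ?orbT.
  (* Up to a factor [u] outside [P'], every element of [P] is a multiple of [x], so [P] is contained
     in [P']. *)
  apply/orP; left; apply/eqP/esym/val_inj/coheight1_eq => //.
    by have /asboolP := svalP P'.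
  move=> a /gen[u [y [_ uP' uE]]].
  have : u * a \in spec_set (sval P') by rewrite uE specMr.
  rewrite specM => /orP[uP|//].
  by case: uP'; exists (sval P').
- by move=> P'; rewrite in_cons => /orP[->//|/s1 /graded_case].
(* The multiplicity at [P] is at most 1: saturation puts [P] inside every [J r], so [J 1], being
   larger than [J 0], contains an element outside [P] and hence all of [R]. *)
move=> m J J1 J2; rewrite leqNgt; apply/negP => lt1m.
have PJ r a : a \in spec_set (sval P) -> J r a.
  move=> /gen[u [y [uP _ uE]]]; have [_ _ Jmul Jsat] := J1 r.
  by apply: (Jsat u) => //; rewrite uE.
have [_ [a Ja nJa]] := J2 0%N (ltnW lt1m).
have [_ [b _ nJb]] := J2 1%N lt1m.
apply: nJb; have [J0 Jlin _ Jsat] := J1 1%N.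
rewrite -[b]mulr1 -[_ * _]addr0; apply: (Jlin) => //.
apply: (Jsat a); last by rewrite mulr1.
by apply/negP => /PJ.
Qed.

End GradedOverPlane.

(** * Graded subrings of the Fermat hypersurface *)

Section FermatSubring.
Variables (k : closedFieldType) (m n : nat) (hm : (1 < m)%N) (hn : (1 < n)%N).
Hypothesis hmn : coprime m n.

Local Notation T := {mpoly k[2]}.
Local Notation S := (ringS k hm hn).
Local Notation f := (fermat_poly k m n).
Local Notation pr := (\pi_({ideal_quot (fermat_ideal (k := k) hm hn)})).

Lemma fermat_quot_eq0 p : pr p = 0 <-> exists q, p = q * f.
Proof.
rewrite -(rmorph0 pr); split=> [/eqP|h].
  by rewrite -Quotient.idealrBE subr0 => /asboolP.
by apply/eqP; rewrite -Quotient.idealrBE subr0; apply/asboolP.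
Qed.

Lemma fermat_quot_surj (s : S) : exists p, pr p = s.
Proof. by exists (repr s); rewrite reprK. Qed.

Lemma fermat_poly_neq0 : f != 0.
Proof.
apply/eqP => /(congr1 (meval (fun s => (s == varY)%:R))).
rewrite !rmorphD !rmorphXn rmorph0 /= !mevalXU /= !expr0n expr1n.
by rewrite (gtn_eqF (ltnW hm)) !add0r => /eqP; rewrite oner_eq0.
Qed.

(** The form of degree [m] that equals the n-th power of Y in [S]. *)
Definition neg_fermat_form : T := - ('X_bvar0 ^+ m + 'X_bvar1 ^+ m).

Lemma mwiden_bvar0 : mwiden 'X_bvar0 = 'X_var1 :> {mpoly k[3]}.
Proof. by rewrite mwidenX mnmwiden1; congr 'X_[U_(_)]; apply: val_inj. Qed.

Lemma mwiden_bvar1 : mwiden 'X_bvar1 = 'X_var2 :> {mpoly k[3]}.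
Proof. by rewrite mwidenX mnmwiden1; congr 'X_[U_(_)]; apply: val_inj. Qed.

Lemma pr_varY_exp : pr 'X_varY ^+ n = pr (mwiden neg_fermat_form).
Proof.
apply/eqP; rewrite -subr_eq0 -rmorphXn -rmorphB; apply/eqP/fermat_quot_eq0.
exists 1; rewrite mul1r /neg_fermat_form rmorphN rmorphD !rmorphXn /=.
by rewrite mwiden_bvar0 mwiden_bvar1 opprK addrC.
Qed.

Lemma neg_fermat_form_homog : neg_fermat_form \is m.-homog.
Proof.
rewrite rpredN rpredD // mpolyXn dhomogX /= mdegMn mdeg1 mul1n //.
Qed.

Lemma neg_fermat_form_neq0 : neg_fermat_form != 0.
Proof.
apply/eqP => /(congr1 (meval (fun s => (s == bvar0)%:R))).
rewrite rmorphN rmorphD !rmorphXn rmorph0 /= !mevalXU /= expr0n expr1n.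
by rewrite (gtn_eqF (ltnW hm)) addr0 => /eqP; rewrite oppr_eq0 oner_eq0.
Qed.

Lemma wdeg_wtS (a : 'X_{1..3}) :
  wdeg (wtS m n) a = (n * (a var1 + a var2) + m * a varY)%N.
Proof.
rewrite /wdeg !big_ord_recl big_ord0 addn0 /wtS /= mulnDr addnA.
by congr (_ * a _ + _ * a _ + _ * a _)%N; apply: val_inj.
Qed.

Lemma mpolyX3E (a : 'X_{1..3}) :
  'X_[a] = 'X_var1 ^+ a var1 * 'X_var2 ^+ a var2 * 'X_varY ^+ a varY :> {mpoly k[3]}.
Proof.
rewrite mpolyXE_id !big_ord_recl big_ord0 mulr1 mulrA.
by congr ('X_ _ ^+ a _ * 'X_ _ ^+ a _ * 'X_ _ ^+ a _); apply: val_inj.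
Qed.

(** Modulo [n] the equation reads [m * y = m * z], and [m] is invertible modulo [n]. *)
Lemma coprime_modn_cancel y z A B : (n * A + m * y = n * B + m * z)%N ->
  (y %% n = z %% n)%N.
Proof.
wlog leyz : y z A B / (z <= y)%N => [WL|] E.
  by case/orP: (leq_total z y) => h; [|symmetry]; apply: WL h _; [exact: E|exact: esym E].
apply/eqP; rewrite eqn_mod_dvd // -(@Gauss_dvdr _ m); last by rewrite coprime_sym.
rewrite (_ : m * (y - z) = n * (B - A))%N ?dvdn_mulr // !mulnBr.
by have := leq_mul (leqnn m) leyz; lia.
Qed.

(* As gcd(m, n) = 1, the degree determines the exponent of Y modulo n. *)
Lemma homogeneous_normal_form d (s : S) : s \in S_graded k hm hn d -> s != 0 ->
  exists c e t, [/\ (c < n)%N, t \is e.-homog, (n * e + m * c = d)%N &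
    s = pr (mwiden t) * pr 'X_varY ^+ c].
Proof.
move=> /asboolP[p hp ->]; rewrite /toS => prp0.
have p0 : p != 0 by apply: contraNneq prp0 => ->; rewrite rmorph0.
(* The degree in [X_1], [X_2] once each full power [Y ^ n] in the monomial is replaced by
   [neg_fermat_form]. *)
pose ex (a : 'X_{1..3}) := (a var1 + a var2 + m * (a varY %/ n))%N.
have degE a : wdeg (wtS m n) a = (n * ex a + m * (a varY %% n))%N.
  rewrite wdeg_wtS {1}(divn_eq (a varY) n) /ex; nia.
pose a0 := mlead p; have a0p : a0 \in msupp p by exact: mlead_supp.
have degp a : a \in msupp p -> wdeg (wtS m n) a = d by exact: (dhomog_mf hp).
have modE a : a \in msupp p -> (a varY %% n = a0 varY %% n)%N.
  move=> ap; apply: (@coprime_modn_cancel _ _ (a var1 + a var2) (a0 var1 + a0 var2)).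
  by rewrite -!wdeg_wtS !degp.
have exE a : a \in msupp p -> ex a = ex a0.
  move=> ap; have := degp _ ap; rewrite -(degp _ a0p) !degE modE // => /addIn/eqP.
  by rewrite eqn_pmul2l ?(ltnW hn) // => /eqP.
pose t : T := \sum_(a <- msupp p)
  p@_a *: ('X_bvar0 ^+ a var1 * 'X_bvar1 ^+ a var2 * neg_fermat_form ^+ (a varY %/ n)).
exists (a0 varY %% n)%N, (ex a0), t; split.
- by rewrite ltn_mod ltnW.
- rewrite /t big_seq; apply: rpred_sum => a ap; rewrite -(exE a ap); apply: rpredZ.
  apply: dhomogM; last exact: dhomogMn neg_fermat_form_homog.
  by apply: dhomogM; rewrite mpolyXn dhomogX /= mdegMn mdeg1 mul1n.
- by rewrite -degE degp.
have -> : mwiden t = \sum_(a <- msupp p) mwiden (p@_a *: ('X_bvar0 ^+ a var1 *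
    'X_bvar1 ^+ a var2 * neg_fermat_form ^+ (a varY %/ n))) by rewrite /t raddf_sum.
rewrite [in LHS](mpolyE p) !rmorph_sum mulr_suml big_seq [RHS]big_seq.
apply: eq_bigr => a ap; rewrite -(modE a ap).
rewrite -!mul_mpolyC !mwidenM mwidenC !rmorphM /= -!mulrA; congr (_ * _).
rewrite mpolyX3E !rmorphM !rmorphXn /= mwiden_bvar0 mwiden_bvar1 -!mulrA.
congr (_ * (_ * _)).
by rewrite -pr_varY_exp -exprM -exprD mulnC -divn_eq.
Qed.

(** * Properties that [R] draws from its embedding in [S] *)

Variables (R : comNzRingType) (G : nat -> {pred R}).
Hypothesis hG : is_grading G.
Variables (i : {rmorphism T -> R}) (j : {rmorphism R -> S}).
Hypotheses (i_inj : injective i) (j_inj : injective j).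
Hypothesis i_graded : graded_map (T_graded k n) G i.
Hypothesis j_graded : graded_map G (S_graded k hm hn) j.
Hypothesis ji : forall p, j (i p) = T_to_S k hm hn p.

Let n_gt0 : (0 < n)%N. Proof. exact: ltnW. Qed.

Lemma plane_homogeneous d t : t \is d.-homog -> i t \in G (n * d)%N.
Proof.
move=> ht; apply: i_graded; apply/dhomogP => a ta.
by rewrite /= /wdeg /wtT -big_distrr -mdegE (dhomog_mf ht).
Qed.

(** The n-th power of [t Y ^ c] is [t ^ n] times the c-th power of [neg_fermat_form], of degree
    [n * e + m * c = d]. *)
Lemma homogeneous_power d a : a \in G d -> a != 0 ->
  exists t, [/\ t \is d.-homog, t != 0 & a ^+ n = i t].
Proof.
move=> Ga a0; have ja0 : j a != 0 by rewrite -(inj_eq j_inj) rmorph0 in a0.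
have [c [e [t [_ ht dE jaE]]]] := homogeneous_normal_form (j_graded Ga) ja0.
exists (t ^+ n * neg_fermat_form ^+ c); split.
- rewrite -dE mulnC; apply: dhomogM; first exact: dhomogMn.
  exact: dhomogMn neg_fermat_form_homog.
- rewrite mulf_neq0 // expf_neq0 //; last exact: neg_fermat_form_neq0.
  by apply: contraNneq ja0 => t0; rewrite jaE t0 mwiden0 rmorph0 mul0r.
apply: j_inj; rewrite ji rmorphXn jaE exprMn -exprM mulnC exprM pr_varY_exp.
by rewrite /T_to_S /toS rmorphM !rmorphXn /= rmorphM !rmorphXn.
Qed.

Lemma module_coordinates (a : R) : exists tau : nat -> T,
  j a = \sum_(c < n) pr (mwiden (tau c)) * pr 'X_varY ^+ c.
Proof.
rewrite [a](sum_components hG) rmorph_sum.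
elim: (size _) => [|D [tau IH]].
  exists (fun=> 0); rewrite big_ord0 big1 // => c _.
  by rewrite mwiden0 rmorph0 mul0r.
rewrite big_ord_recr /= IH.
have [->|ja0] := eqVneq (j (components hG a)`_D) 0; first by exists tau; rewrite addr0.
have [c [e [t [ltc _ _ ->]]]] := homogeneous_normal_form (j_graded (component_in hG a D)) ja0.
exists (fun c' => tau c' + (if c' == c then t else 0)).
rewrite [RHS](eq_bigr (fun c' : 'I_n => pr (mwiden (tau c')) * pr 'X_varY ^+ c' +
  (if c' == Ordinal ltc then pr (mwiden t) * pr 'X_varY ^+ c else 0))).
  by rewrite big_split /= -big_mkcond big_pred1_eq.
move=> c' _; rewrite -val_eqE /= mwidenD rmorphD mulrDl; congr (_ + _).
by case: eqP => [->|_] //; rewrite mwiden0 rmorph0 mul0r.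
Qed.

(** The elements have coordinates in the [n] powers of Y below [Y ^ n]. A zero column completes the
    coordinate matrix to a square one of determinant 0, whose left kernel over the domain [T] gives
    the relation. *)
Lemma module_rank_le (a : 'I_n.+1 -> R) : exists v : 'I_n.+1 -> T,
  (exists s, v s != 0) /\ \sum_s i (v s) * a s = 0.
Proof.
have /choice[tau tauE] := fun s => module_coordinates (a s).
pose M : 'M[T]_n.+1 := \matrix_(s, c) if (c < n)%N then tau s c else 0.
have /eqP/det0P[v v0 vM] : \det M = 0.
  rewrite (expand_det_col _ ord_max) big1 // => s _.
  by rewrite mxE /= ltnn mul0r.
exists (fun s => v ord0 s); split.
  apply: contrapT => nex; case/eqP: v0; apply/rowP => s; rewrite mxE.
  by apply: contrapT => /eqP vs; apply: nex; exists s.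
apply: j_inj; rewrite rmorph0 rmorph_sum.
under eq_bigr => s _ do rewrite rmorphM ji tauE mulr_sumr.
rewrite exchange_big big1 //= => c _.
have := congr1 (fun w : 'rV_n.+1 => w ord0 (widen_ord (leqnSn n) c)) vM.
rewrite !mxE => vMc.
under eq_bigr => s _ do rewrite mulrA.
rewrite -mulr_suml (_ : \sum_s _ =
  pr (mwiden (\sum_s v ord0 s * M s (widen_ord (leqnSn n) c)))).
  by rewrite vMc mwiden0 rmorph0 mul0r.
have -> : mwiden (\sum_s v ord0 s * M s (widen_ord (leqnSn n) c)) =
  \sum_s mwiden (v ord0 s * M s (widen_ord (leqnSn n) c)) by rewrite raddf_sum.
rewrite rmorph_sum; apply: eq_bigr => s _.
by rewrite mxE /= ltn_ord mwidenM rmorphM.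
Qed.

Lemma subring_dim_le2 (P : spec R) l : chain_above P l -> (l <= 2)%N.
Proof.
move=> [c [_ hc]].
apply: (@chain_length_le2 k R S f pr j (fun a => i a%:MP) c l) => //.
- by move=> a; rewrite ji /T_to_S /toS mwidenC.
- exact: fermat_quot_surj.
- exact: fermat_poly_neq0.
- exact: fermat_quot_eq0.
Qed.

(** As [phi] kills [f], it factors through [S], and [P] is the kernel of the factored map restricted
    to [R]. Lifts [p] of [j a] express this without building that map. *)
Lemma kernel_prime (D : idomainType) (phi : {rmorphism {mpoly k[3]} -> D}) : phi f = 0 ->
  exists P : spec R, forall p a, pr p = j a -> (a \in spec_set P <-> phi p = 0).
Proof.
move=> phif.
have phi_wd p q : pr p = pr q -> phi p = phi q.
  move=> /eqP; rewrite -subr_eq0 -rmorphB => /eqP/fermat_quot_eq0[r].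
  by move=> /(congr1 phi)/eqP; rewrite rmorphB rmorphM phif mulr0 subr_eq0 => /eqP.
have [|[p [p1 phip]]|b x y [p [px phip]] [q [qy phiq]]|x y [p [pxy phip]]|P hP] :=
    @spec_of_predicate R (fun a => exists p, pr p = j a /\ phi p = 0).
- by exists 0; rewrite !rmorph0.
- have /phi_wd : pr p = pr 1 by rewrite p1 !rmorph1.
  by rewrite phip rmorph1 => /esym/eqP; rewrite oner_eq0.
- have [r rb] := fermat_quot_surj (j b); exists (r * p + q).
  have -> : pr (r * p + q) = pr r * pr p + pr q by rewrite rmorphD rmorphM.
  by rewrite rb px qy !rmorphD !rmorphM phip phiq mulr0 addr0.
- have [q qx] := fermat_quot_surj (j x); have [r ry] := fermat_quot_surj (j y).
  have /phi_wd : pr (q * r) = pr p.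
    have -> : pr (q * r) = pr q * pr r by rewrite rmorphM.
    by rewrite pxy rmorphM qx ry.
  rewrite phip rmorphM => /eqP; rewrite mulf_eq0 => /orP[]/eqP h; [left|right].
    by exists q.
  by exists r.
exists P => p a pa; split=> [/hP[q [qa <-]]|phip]; last by apply/hP; exists p.
by apply: phi_wd; rewrite pa qa.
Qed.

(* The chain 0 < P_1 < P_2 cut out by the curve (al z^n, 0, z^m) on the surface
   and by its point at the origin, where al^m = -1. *)
Lemma subring_dim_ge2 : exists P : spec R, chain_above P 2.
Proof.
have [al alE] : exists al : k, al ^+ m = -1.
  have [al alE] := @solve_monicpoly k m (fun s => if s == 0%N then -1 else 0) (ltnW hm).
  exists al; rewrite alE -[m](prednK (ltnW hm)) big_ord_recl /= expr0 mulr1 big1 ?addr0 //.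
  by move=> s _; rewrite mul0r.
have al0 : al != 0.
  apply/eqP => al0; move/eqP: alE; rewrite al0 expr0n (gtn_eqF (ltnW hm)).
  by rewrite eq_sym oppr_eq0 oner_eq0.
pose h (s : 'I_3) : {poly k} :=
  if s == var1 then al *: 'X^n else if s == var2 then 0 else 'X^m.
pose phi : {rmorphism {mpoly k[3]} -> {poly k}} := mmap polyC h.
have phiX s : phi 'X_s = h s by rewrite /phi /= mmapX mmap1U.
have phif : phi f = 0.
  rewrite /fermat_poly !rmorphD !rmorphXn !phiX /h /=.
  rewrite expr0n (gtn_eqF (ltnW hm)) addr0 exprZn alE -!exprM mulnC.
  by rewrite scaleN1r addNr.
pose psi : {rmorphism {mpoly k[3]} -> k} := horner_eval 0 \o phi.
have psif : psi f = 0 by rewrite /psi /= phif rmorph0.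
have [P1 hP1] := kernel_prime phif; have [P2 hP2] := kernel_prime psif.
have [Z hZ] := zero_prime hG n_gt0 i_inj homogeneous_power.
have rep0 : pr 'X_var1 = j (i 'X_bvar0) by rewrite ji /T_to_S /toS mwiden_bvar0.
have rep1 : pr 'X_var2 = j (i 'X_bvar1) by rewrite ji /T_to_S /toS mwiden_bvar1.
(* [X_2] vanishes on the curve but is nonzero in [R]; in the next step, [X_1] vanishes at the origin
   but not on the curve. *)
have ZP1 : proper_subset (spec_set Z) (spec_set P1).
  split=> [y /hZ ->|sub]; first exact: rpred0.
  have /sub/hZ : i 'X_bvar1 \in spec_set P1 by apply/(hP1 _ _ rep1); rewrite phiX.
  rewrite -(rmorph0 i) => /i_inj/eqP; rewrite -msize_poly_eq0.
  by rewrite (msizeX k U_(bvar1)).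
have P1P2 : proper_subset (spec_set P1) (spec_set P2).
  split=> [a aP1|sub].
    have [p pa] := fermat_quot_surj (j a); apply/(hP2 _ _ pa).
    by rewrite /psi /= (iffLR (hP1 _ _ pa) aP1) rmorph0.
  have /sub/(hP1 _ _ rep0) : i 'X_bvar0 \in spec_set P2.
    apply/(hP2 _ _ rep0); rewrite /psi /= phiX /h /= /horner_eval hornerZ hornerXn.
    by rewrite expr0n (gtn_eqF n_gt0) mulr0.
  rewrite phiX /h /= => /eqP; rewrite scaler_eq0 (negPf al0) /=.
  by rewrite -size_poly_eq0 size_polyXn.
exists Z; apply: (chain_above_cons ZP1); apply: (chain_above_cons P1P2).
exact: chain_above0.
Qed.

End FermatSubring.

Theorem mainTheorem1 (k : closedFieldType) (m n : nat)
    (hm : (1 < m)%N) (hn : (1 < n)%N) (hmn : coprime m n)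
    (hk : ((m * n)%:R : k) \is a GRing.unit)
    (R : comNzRingType) (G : nat -> {pred R}) (hG : is_grading G)
    (i : {rmorphism {mpoly k[2]} -> R}) (j : {rmorphism R -> ringS k hm hn})
    (i_inj : injective i) (j_inj : injective j)
    (i_graded : graded_map (T_graded k n) G i)
    (j_graded : graded_map G (S_graded k hm hn) j)
    (ji : forall p, j (i p) = T_to_S k hm hn p) :
  is_torsion (chow R 1).
Proof.
apply: (@chow1_torsion k n n.+1 R G hG i (ltnW hn) i_inj).
- exact: plane_homogeneous i_graded.
- by move=> d a; exact: (homogeneous_power hmn j_inj j_graded ji).
- exact: (module_rank_le hmn hG j_inj j_graded ji).
- by move=> P l; exact: (subring_dim_le2 j_inj ji).
- exact: (subring_dim_ge2 hmn hG i_inj j_inj j_graded ji).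
Qed.
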